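(* Let $Y$ be a connected, locally path connected, first countable, Hausdorff topological space and let $S$ be a skeletal subset of $Y$. If $Y\setminus S$ is semi-locally simply connected, then there exists a covering $\widetilde Y^S\to Y$ possibly branched over $S$ which is maximal among coverings of $Y$ possibly branched over $S$. Furthermore, $\widetilde Y^S$ is unique up to isomorphism, and it is universal in the sense that for any covering $p:X\to Y$ possibly branched over $S$ there exists a covering $\widetilde Y^S\to X$ (compatible with the projections to $Y$) possibly branched over $p^{-1}(S)$.
   Context: All topological spaces are Hausdorff, locally path connected and first countable. A subset $D$ of a space $X$ is locally connected in $X$ if $U\cap D$ is connected for every open connected $U\subset X$. A subset is portly in $X$ if it is open, dense and locally connected in $X$; a subset is skeletal if its complement is portly. A spread $p:X\to Y$ is a continuous map such that the connected components of preimages $p^{-1}(U)$ of open subsets $U\subset Y$ generate the topology of $X$. It is complete if for every $y\in\overline{p(X)}$ and every inclusion-increasing assignment $\chi$ associating to each open connected neighborhood $U$ of $y$ a connected component $\chi(U)$ of $p^{-1}(U)$, one has $\bigcap_U\chi(U)\neq\emptyset$. The ordinary locus $\mathrm{Ord}(Y)$ is the set of $y\in Y$ having an open neighborhood $U$ evenly covered by $p$ (each connected component of $p^{-1}(U)$ is mapped homeomorphically onto $U$ by $p$), and $\mathrm{Ord}(X)=p^{-1}(\mathrm{Ord}(Y))$. A branched covering is a complete surjective spread $X\to Y$ with $X,Y$ connected and with $\mathrm{Ord}(X)$, $\mathrm{Ord}(Y)$ portly in $X$, $Y$ respectively. Its branching locus is $Y\setminus\mathrm{Ord}(Y)$; a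 ''covering possibly branched over $S$'' is a branched covering whose branching locus is contained in $S\subset Y$. Two branched coverings of $Y$ are isomorphic if there is a homeomorphism between total spaces commuting with the projections to $Y$; a branched covering $X_1\to Y$ is larger than $X_2\to Y$ if there is a branched covering $X_1\to X_2$ commuting with the projections to $Y$. A space $Z$ is semi-locally simply connected if every point $z$ has a neighborhood $U$ such that every loop in $U$ based at $z$ is null-homotopic in $Z$. *)

(* Defs.v *)
From HB Require Import structures.
From mathcomp Require Import all_boot all_order all_algebra.
From mathcomp Require Import all_classical all_reals all_analysis.

Set Implicit Arguments.
Unset Strict Implicit.
Unset Printing Implicit Defensive.

Import Order.TTheory GRing.Theory Num.Theory numFieldNormedType.Exports.
Local Open Scope classical_set_scope.
Local Open Scope ring_scope.

(* Throughout, a path is a function [R -> X] of which only the restriction to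
   [0, 1] matters. *)

Definition path_in (R : realType) (X : topologicalType) (A : set X) (x y : X)
    (g : R -> X) : Prop :=
  [/\ {within `[0, 1], continuous g}, g 0 = x, g 1 = y & g @` `[0, 1] `<=` A].

Definition path_connected (R : realType) (X : topologicalType) (A : set X) :=
  forall x y, A x -> A y -> exists g : R -> X, path_in A x y g.

Definition locally_path_connected (R : realType) (X : topologicalType) :=
  forall (x : X) (U : set X), nbhs x U ->
    exists V, [/\ open V, V x, path_connected R V & V `<=` U].

Definition first_countable (X : topologicalType) :=
  forall x : X, exists B : set (set X),
    [/\ countable B, B `<=` nbhs x &
        forall U, nbhs x U -> exists2 V, B V & V `<=` U].

(* The standing assumption on all topological spaces. *)
Definition admissible_space (R : realType) (X : topologicalType) :=
  [/\ hausdorff_space X, locally_path_connected R X & first_countable X].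

(* Homotopies are relative to the end points; [H (s, t)] is the position at
   time [t] on the [s]-th loop. *)
Definition null_homotopic (R : realType) (Z : topologicalType) (z : Z)
    (g : R -> Z) : Prop :=
  exists H : R * R -> Z,
    [/\ {within `[0, 1] `*` `[0, 1], continuous H},
        forall t, t \in `[0, 1] -> H (0, t) = g t,
        forall t, t \in `[0, 1] -> H (1, t) = z &
        forall s, s \in `[0, 1] -> H (s, 0) = z /\ H (s, 1) = z].

Definition semilocally_simply_connected (R : realType) (Z : topologicalType) :=
  forall z : Z, exists2 U : set Z, nbhs z U &
    forall g : R -> Z, path_in U z z g -> null_homotopic z g.

Definition locally_connected_in (X : topologicalType) (D : set X) :=
  forall U : set X, open U -> connected U -> connected (U `&` D).

Definition portly (X : topologicalType) (D : set X) :=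
  [/\ open D, dense D & locally_connected_in D].

Definition skeletal (X : topologicalType) (S : set X) := portly (~` S).

(* Connected components are nonempty: the base point ranges over [A]. *)
Definition components (X : topologicalType) (A : set X) : set (set X) :=
  connected_component A @` A.

(* [B] is a subbase of the topology of [X]. *)
Definition generates_topology (X : topologicalType) (B : set (set X)) :=
  @open X = [set \bigcup_(A in F) A | F in [set F | F `<=` finI_from B id]].

Definition homeomorphism (X Y : topologicalType) (f : X -> Y) :=
  continuous f /\
  exists g : Y -> X, [/\ continuous g, cancel f g & cancel g f].

(* [f] restricts to a homeomorphism from the subspace [C] onto the subspace
   [U]. *)
Definition homeomorphism_on (X Y : topologicalType) (f : X -> Y)
    (C : set X) (U : set Y) :=
  {within C, continuous f} /\ f @` C = U /\
  exists g : Y -> X,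
    [/\ {within U, continuous g}, g @` U = C &
        forall x, C x -> g (f x) = x].

Section maps.
Context (R : realType) (X Y : topologicalType).
Implicit Types (p : X -> Y) (S : set Y).

Definition spread p :=
  continuous p /\
  generates_topology
    (\bigcup_(U in @open Y) components (p @^-1` U)).

Definition conn_open_nbhs (y : Y) : set (set Y) :=
  [set U | [/\ open U, connected U & U y]].

Definition complete p :=
  forall (y : Y) (chi : set Y -> set X),
    closure (range p) y ->
    (forall U, conn_open_nbhs y U -> components (p @^-1` U) (chi U)) ->
    (forall U V, conn_open_nbhs y U -> conn_open_nbhs y V ->
       U `<=` V -> chi U `<=` chi V) ->
    \bigcap_(U in conn_open_nbhs y) chi U !=set0.

Definition evenly_covered p (U : set Y) :=
  forall C, components (p @^-1` U) C -> homeomorphism_on p C U.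

Definition ordinary p : set Y :=
  [set y | exists U, [/\ open U, U y & evenly_covered p U]].

Definition ordinary_total p : set X := p @^-1` ordinary p.

Definition branched_covering p :=
  [/\ admissible_space R X /\ admissible_space R Y,
      connected [set: X] /\ connected [set: Y],
      spread p /\ complete p,
      range p = [set: Y] &
      portly (ordinary_total p) /\ portly (ordinary p)].

Definition branching_locus p : set Y := ~` ordinary p.

Definition covering_branched_over S p :=
  branched_covering p /\ branching_locus p `<=` S.

End maps.

Section comparison.
Context (R : realType) (Y : topologicalType).

Definition isomorphic_over (X1 X2 : topologicalType)
    (p1 : X1 -> Y) (p2 : X2 -> Y) :=
  exists2 h : X1 -> X2, homeomorphism h & p2 \o h = p1.

Definition larger (X1 X2 : topologicalType) (p1 : X1 -> Y) (p2 : X2 -> Y) :=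
  exists2 q : X1 -> X2, branched_covering R q & p2 \o q = p1.

(* [larger] is only a preorder on isomorphism classes, so maximality is taken
   in the sense of preorders. *)
Definition maximal_branched_over (S : set Y) (X : topologicalType)
    (p : X -> Y) :=
  covering_branched_over R S p /\
  forall (X' : topologicalType) (p' : X' -> Y),
    covering_branched_over R S p' -> larger p' p -> larger p p'.

End comparison.

(* Main.v *)
(** The space [Y \ S] is covered by connected open sets which are
    evenly covered by every covering of [Y] branched over [S]: if all loops in
    [W] contract in [Y \ S], two points of one component of [p^-1(W)] in the
    same fibre are the ends of a lift of such a loop, and hence coincide.
    Transport along chains of such "trivializing" sets acts on the fibres of all
    branched coverings at once.  Identifying chains with the same end and the
    same action on every pointed branched covering gives the universal covering
    of [Y \ S] without any use of homotopy classes, and its Fox completion, whose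
    points over [y] are compatible choices of components over the connected
    neighbourhoods of [y], is the required branched covering.  A pointed covering
    [X] receives a map from it by transport, extended by completeness of [X].
    Every continuous map over [Y] between coverings branched over [S] is itself
    a branched covering, and the pointed universal property turns every
    endomorphism of the completion into an automorphism: this yields both
    maximality and uniqueness. *)

Require Import Defs.
From HB Require Import structures.
From mathcomp Require Import all_boot all_order all_algebra.
From mathcomp Require Import finmap lra.
From mathcomp Require Import all_classical all_reals all_analysis.

Set Implicit Arguments.
Unset Strict Implicit.
Unset Printing Implicit Defensive.

Import Order.TTheory GRing.Theory Num.Theory numFieldNormedType.Exports.
Local Open Scope classical_set_scope.
Local Open Scope ring_scope.

(** * Connectedness *)

(** The obstacle is the lack of control over the fibres above [S], where neither local sections nor
    path lifting are available. Two assumptions compensate. Since [V \ S] stays connected for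
    connected open [V], a component over [V] already covers all of [V \ S]. Since points have
    countable neighbourhood bases, coherent families of components can be built along nested
    sequences: this derives surjectivity from completeness, and it links a point of the completion
    above [S] to chains by an infinite concatenation of shrinking paths. The unbranched covering is
    never built as a space: a component of it over [U] is represented by its chains, a class of
    [joined U], and the completion is assembled from these classes directly. Equivalence of chains
    quantifies over all pointed coverings; being a proposition, it does not enlarge the type of the
    completion, which can thus be one of the coverings it is tested against. *)

Definition locally_connected (X : topologicalType) :=
  forall (x : X) (U : set X), nbhs x U ->
    exists V, [/\ open V, connected V, V x & V `<=` U].

(** The trace of [P] is open and closed in [A]. This is an induction principle along connected sets,
    standing in for path lifting in many arguments below. *)
Lemma locally_constant_connected (X : topologicalType) (A P : set X) (x : X) :
  connected A -> A x -> P x ->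
  (forall y, A y -> \forall z \near y, A z -> (P y <-> P z)) -> A `<=` P.
Proof.
move=> cA Ax Px loc; suff /setIidPl : A `&` P = A by [].
apply: cA; first by exists x.
  exists (interior [set z | A z -> P z]); first exact: open_interior.
  apply/seteqP; split=> y [Ay].
    by move=> Py; split => //; apply: filterS (loc y Ay) => z H /H [+ _]; apply.
  by move=> /interior_subset H; split => //; exact: H.
exists (~` interior [set z | A z -> ~ P z]).
  exact/open_closedC/open_interior.
apply/seteqP; split=> y [Ay].
  by move=> Py; split => // /interior_subset; exact.
move=> nP; split => //; apply: contrapT => nPy; apply: nP.
by apply: filterS (loc y Ay) => z H /H [_]; tauto.
Qed.

Lemma connected_from (X : topologicalType) (A : set X) (x : X) :
  (forall y, A y -> connected_component A x y) -> connected A.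
Proof.
move=> H; suff <- : connected_component A x = A by exact: component_connected.
by apply/seteqP; split => //; exact: connected_component_sub.
Qed.

Lemma sub_connected_component (X : topologicalType) (A B : set X) (x : X) :
  A `<=` B -> connected_component A x `<=` connected_component B x.
Proof.
move=> AB y [C [Cx CA cC] Cy]; exists C => //; split => //.
exact: subset_trans AB.
Qed.

Lemma path_connected_component (R : realType) (X : topologicalType) (A : set X)
    (x y : X) (g : R -> X) :
  path_in A x y g -> connected_component A x y.
Proof.
move=> [cg g0 g1 gA]; exists (g @` `[0, 1]); last first.
  by exists 1 => //=; rewrite in_itv /= lexx ler01.
split => //; first by exists 0 => //=; rewrite in_itv /= lexx ler01.
exact/connected_continuous_connected/cg/segment_connected.
Qed.

Lemma path_connected_connected (R : realType) (X : topologicalType)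
    (A : set X) :
  path_connected R A -> connected A.
Proof.
move=> pA; have [->|/set0P[x Ax]] := eqVneq A set0; first exact: connected0.
apply: (@connected_from _ _ x) => y Ay; have [g] := pA x y Ax Ay.
exact: path_connected_component.
Qed.

Lemma locally_path_connectedW (R : realType) (X : topologicalType) :
  locally_path_connected R X -> locally_connected X.
Proof.
move=> lX x U /lX [V [oV Vx pV VU]]; exists V; split => //.
exact: path_connected_connected pV.
Qed.

Lemma component_open (X : topologicalType) (A : set X) (x : X) :
  locally_connected X -> open A -> open (connected_component A x).
Proof.
move=> lX; rewrite !openE => oA y Cy.
have /lX [V [oV cV Vy VA]] := oA _ (connected_component_sub Cy).
apply: (@filterS _ _ _ V); last exact: open_nbhs_nbhs.
rewrite (same_connected_component Cy); exact: connected_component_max.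
Qed.

Lemma componentsP (X : topologicalType) (A C : set X) :
  components A C ->
  C !=set0 /\ forall x, C x -> A x /\ C = connected_component A x.
Proof.
move=> [x Ax <-]; split; first by exists x; exact: connected_component_refl.
move=> y Cy; split; first exact: connected_component_sub Cy.
exact: same_connected_component.
Qed.

(** Belonging to [F i] is locally constant on [A], as the members are open and pairwise equal or
    disjoint. This later identifies components in the completion. *)
Lemma open_connected_cover_components (X : topologicalType) (I : Type)
    (D : set I) (F : I -> set X) (A : set X) :
  A = \bigcup_(i in D) F i ->
  (forall i, D i -> open (F i) /\ connected (F i)) ->
  (forall i j x, D i -> D j -> F i x -> F j x -> F i = F j) ->
  forall i x, D i -> F i x -> connected_component A x = F i.
Proof.
move=> AE oF dF i x Di Fx; have FA : F i `<=` A by rewrite AE; exact: bigcup_sup.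
apply/seteqP; split; last first.
  by apply: connected_component_max => //; exact: (oF _ Di).2.
apply: (@locally_constant_connected _ _ _ x) => //.
- exact: component_connected.
- by apply: connected_component_refl; exact: FA.
move=> y /connected_component_sub; rewrite {1}AE => -[j Dj Fy].
apply: (@filterS _ _ _ (F j)); last first.
  by apply: open_nbhs_nbhs; split => //; exact: (oF _ Dj).1.
move=> z Fz _; split => H; first by rewrite (dF i j y).
by rewrite (dF i j z).
Qed.

Lemma hausdorff_conn_nbhs (X : topologicalType) (x y : X) :
  hausdorff_space X -> locally_connected X ->
  (forall U, conn_open_nbhs x U -> U y) -> x = y.
Proof.
move=> hX lX H; apply: hX => A B /lX [V [oV cV Vx VA]] By; exists y; split.
  by apply: VA; apply: H.
exact: nbhs_singleton.
Qed.

Lemma conn_nbhs_sequence (X : topologicalType) (x : X) :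
  first_countable X -> locally_connected X ->
  exists U : nat -> set X,
    [/\ forall n, conn_open_nbhs x (U n), forall n, U n.+1 `<=` U n &
        forall V, nbhs x V -> exists n, U n `<=` V].
Proof.
move=> /(_ x) [B [/countable_injP [f /= finj] Bx Bbase]] lX.
(* The injection [f] indexes the base; an index that it misses gets [setT], so that every [g n] is a
   neighbourhood of [x]. *)
pose g n := xget setT [set W | B W /\ f W = n].
have gx n : nbhs x (g n).
  by rewrite /g; case: xgetP => [W _ [/Bx]//|_]; exact: filterT.
pose h (V : set X) :=
  xget set0 [set W | conn_open_nbhs x W /\ (nbhs x V -> W `<=` V)].
have hP V : nbhs x V -> conn_open_nbhs x (h V) /\ h V `<=` V.
  move=> xV; rewrite /h; case: xgetP => [W _ [? /(_ xV)]//|].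
  have [W [oW cW Wx WV]] := lX _ _ xV => /(_ W) []; split => //.
have hx V : nbhs x V -> nbhs x (h V).
  by move=> /hP [[? ? ?] _]; exact: open_nbhs_nbhs.
pose U := fix U n := if n is m.+1 then h (U m `&` g n) else h (g 0%N).
have xU n : nbhs x (U n).
  elim: n => [|n IH] /=; first exact: hx.
  by apply: hx; exact: filterI.
exists U; split => [[|n]|n|V /Bbase [W BW WV]].
- exact: (hP _ _).1.
- by apply: (hP _ _).1; exact: filterI.
- have [|_ hU] := hP (U n `&` g n.+1); first exact: filterI.
  by move=> y /hU [].
exists (f W); apply: subset_trans WV.
have gW : g (f W) `<=` W.
  rewrite /g; case: xgetP => [W' _ [BW' e]|/(_ W) []//].
  by rewrite (finj W' W) // inE.
apply: subset_trans gW; case: (f W) => [|n] /=; first exact: (hP _ _).2.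
have [|_ hU] := hP (U n `&` g n.+1); first exact: filterI.
by move=> y /hU [].
Qed.

Lemma within_continuous_compS (X Y Z : topologicalType) (A : set X) (B : set Y)
    (f : X -> Y) (g : Y -> Z) :
  {within A, continuous f} -> {within B, continuous g} -> f @` A `<=` B ->
  {within A, continuous (g \o f)}.
Proof.
move=> /subspace_continuousP cf /subspace_continuousP cg fAB.
apply/subspace_continuousP => x Ax U /(cg _ (fAB _ (imageP f Ax))) gU.
have : nbhs x (fun y => A y -> B (f y) -> U (g (f y))) := cf x Ax _ gU.
apply: (@filterS _ (nbhs x)) => y h Ay; apply: h => //.
by apply: fAB; exists y.
Qed.

(** * Evenly covered sets and spreads *)

Lemma connected_between (X : topologicalType) (A B : set X) :
  connected A -> A `<=` B -> B `<=` closure A -> connected B.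
Proof.
move=> cA AB BA; apply/connectedP => E [E0 BE sE].
have sEb b : closure (E b) `&` E (~~ b) = set0.
  by case: sE => s1 s2; case: b => //=; rewrite setIC.
have key b : ~ A `<=` E b.
  move=> AE; have [x Ex] := E0 (~~ b).
  have : (closure (E b) `&` E (~~ b)) x.
    split => //; apply: (closureS AE); apply: BA; rewrite BE.
    by case: b Ex {AE} => /=; [left|right].
  by rewrite sEb.
by have [|/key|/key] := connected_subset sE _ cA; first by rewrite -BE.
Qed.

(** By density of [D], the trace of [D'] on a connected open set lies between the connected trace of
    [D] and its closure. *)
Lemma portly_sup (X : topologicalType) (D D' : set X) :
  portly D -> open D' -> D `<=` D' -> portly D'.
Proof.
move=> [oD dD cD] oD' DD'; split => //.
  by move=> O O0 /(dD O O0) [x [Ox Dx]]; exists x; split => //; exact: DD'.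
move=> U oU cU; apply: (connected_between (cD U oU cU)).
  by move=> x [Ux /DD'].
move=> x [Ux D'x] N; rewrite nbhsE => -[N' [oN' N'x] N'N].
have [||y [[[N'y Uy] D'y] Dy]] := dD ((N' `&` U) `&` D').
- by exists x.
- by apply: openI => //; exact: openI.
by exists y; split; [split|exact: N'N].
Qed.

(** For a component [K] of the trace of [D] on [V], membership in the closure of [K] is locally
    constant on [V]: a neighbourhood with connected trace has this trace inside [K] or disjoint from
    it. Local connectedness of [D] is thereby reduced to small neighbourhoods. *)
Lemma dense_locally_connected (X : topologicalType) (D V : set X) :
  dense D -> open V -> connected V ->
  (forall x, V x -> exists N, [/\ nbhs x N, N `<=` V & connected (N `&` D)]) ->
  connected (V `&` D).
Proof.
move=> dD oV cV H; have [->|/set0P[a [Va Da]]] := eqVneq (V `&` D) set0.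
  exact: connected0.
apply: (@connected_from _ _ a) => y [Vy Dy].
set K := connected_component (V `&` D) a.
have clK x N : N `<=` V -> connected (N `&` D) -> nbhs x N ->
    closure K x <-> N `&` D `<=` K.
  move=> NV cN xN; split=> [/(_ _ xN) [z [Kz Nz]] w Nw|NK M xM].
    apply: (connected_component_trans Kz); exists (N `&` D) => //.
    split => //; last by move=> v [/NV].
    by split => //; have [] := connected_component_sub Kz.
  have [||z [[Mz Nz] Dz]] := dD (interior M `&` interior N).
  - by exists x.
  - by apply: openI; exact: open_interior.
  exists z; split; last exact: interior_subset.
  by apply: NK; split => //; exact: interior_subset.
have Ka : K a by exact: connected_component_refl.
suff : V `<=` closure K.
  have [N [yN NV cN]] := H _ Vy.
  move=> /(_ _ Vy) /(clK _ _ NV cN yN); apply; split => //.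
  exact: nbhs_singleton.
apply: (locally_constant_connected cV Va); first exact: subset_closure.
move=> x /H [N [xN NV cN]]; apply: filterS (nbhs_interior xN) => z Nz _.
have zN : nbhs z N by rewrite /interior in Nz.
by split => [/(clK x N NV cN xN)|/(clK z N NV cN zN)] h;
  [apply/(clK z N NV cN zN)|apply/(clK x N NV cN xN)].
Qed.

Section evenly_covered.
Context (X Y : topologicalType) (p : X -> Y).

Lemma evenly_covered_surj (W : set Y) (x : X) (y : Y) :
  evenly_covered p W -> W (p x) -> W y ->
  exists2 x', connected_component (p @^-1` W) x x' & p x' = y.
Proof.
move=> ev Wx; have [|_ [im _]] := ev (connected_component (p @^-1` W) x).
  by exists x.
by rewrite -{1}im => -[x' ? <-]; exists x'.
Qed.

Lemma evenly_covered_inj (W : set Y) (x x1 x2 : X) :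
  evenly_covered p W -> connected_component (p @^-1` W) x x1 ->
  connected_component (p @^-1` W) x x2 -> p x1 = p x2 -> x1 = x2.
Proof.
move=> ev x1C x2C e.
have [|_ [_ [g [_ _ gp]]]] := ev (connected_component (p @^-1` W) x).
  exists x => //; apply: (connected_component_sub (x := x1)).
  exact: connected_component_sym.
by rewrite -(gp _ x1C) e gp.
Qed.

Lemma evenly_covered_section (W : set Y) (x : X) :
  evenly_covered p W -> W (p x) ->
  exists g : Y -> X, [/\ {within W, continuous g},
    g @` W = connected_component (p @^-1` W) x,
    forall z, connected_component (p @^-1` W) x z -> g (p z) = z &
    forall y, W y -> p (g y) = y].
Proof.
move=> ev Wx.
have [|_ [im [g [cg gW gp]]]] := ev (connected_component (p @^-1` W) x).
  by exists x.
exists g; split => // y; rewrite -im => -[z Cz <-].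
by rewrite gp.
Qed.

(** The section over [W] maps [W'] onto a connected set, which is then the whole component. The form
    with an arbitrary connected [W'] serves for the images of grid edges when loops are lifted. *)
Lemma evenly_covered_sub (W W' : set Y) :
  evenly_covered p W -> connected W' -> W' `<=` W -> evenly_covered p W'.
Proof.
move=> ev cW' W'W C [x W'x <-].
have sub := sub_connected_component (x := x) (preimage_subset (f := p) W'W).
have [|cp _] := ev (connected_component (p @^-1` W) x).
  by exists x => //; exact: W'W.
have [g [cg gW gp pg]] := evenly_covered_section ev (W'W _ W'x).
have gW' : g @` W' = connected_component (p @^-1` W') x.
  apply/seteqP; split => [|z Cz]; last first.
    exists (p z); first exact: connected_component_sub Cz.
    by apply: gp; exact: sub.
  apply: connected_component_max.
  - exists (p x) => //; apply: gp; apply: connected_component_refl.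
    exact: W'W.
  - by move=> _ [y W'y <-]; rewrite /preimage /= pg //; exact: W'W.
  - apply: connected_continuous_connected => //.
    exact: continuous_subspaceW cg.
split; first exact: continuous_subspaceW cp.
split; first rewrite -gW'.
  apply/seteqP; split=> [_ [_ [y W'y <-] <-]|y W'y].
    by rewrite pg //; exact: W'W.
  by exists (g y); [exists y|rewrite pg //; exact: W'W].
exists g; split => //; first exact: continuous_subspaceW cg.
by move=> z /sub /gp.
Qed.

Lemma ordinary_open : open (ordinary p).
Proof.
rewrite openE => y [U [oU Uy ev]]; rewrite /interior nbhsE; exists U => //.
by move=> z Uz; exists U.
Qed.

Lemma ordinary_nbhs (y : Y) (O : set Y) :
  locally_connected Y -> ordinary p y -> nbhs y O ->
  exists W, [/\ conn_open_nbhs y W, W `<=` O & evenly_covered p W].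
Proof.
move=> lY [U [oU Uy ev]] yO.
have [|V [oV cV Vy VUO]] := lY y (U `&` O).
  by apply: filterI => //; exact: open_nbhs_nbhs.
exists V; split => //; first by move=> z /VUO [].
by apply: evenly_covered_sub ev cV _ => z /VUO [].
Qed.

(** An evenly covered neighbourhood inside [V] is either entirely hit by the component or entirely
    missed, so being hit is locally constant on the connected trace of [D]. *)
Lemma component_image (D V : set Y) (x : X) :
  locally_connected Y -> D `<=` ordinary p -> open V -> connected (V `&` D) ->
  V (p x) -> D (p x) ->
  V `&` D `<=` p @` connected_component (p @^-1` V) x.
Proof.
move=> lY DO oV cV Vx Dx.
apply: (locally_constant_connected (x := p x) cV) => //.
  by exists x => //; exact: connected_component_refl.
move=> y [Vy Dy].
have [|W [[oW cW Wy] WV ev]] := ordinary_nbhs (O := V) lY (DO _ Dy).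
  exact: open_nbhs_nbhs.
apply: (@filterS _ _ _ W); last exact: open_nbhs_nbhs.
have key y1 y2 : W y1 -> W y2 ->
  (p @` connected_component (p @^-1` V) x) y1 ->
  (p @` connected_component (p @^-1` V) x) y2.
  move=> Wy1 Wy2 [x1 x1C e]; rewrite -e in Wy1.
  have [x2 x2C <-] := evenly_covered_surj ev Wy1 Wy2.
  exists x2 => //; apply: connected_component_trans x1C _.
  by apply: sub_connected_component x2C; exact: preimage_subset.
by move=> z Wz _; split; exact: key.
Qed.

End evenly_covered.

(** Over nested connected neighbourhoods [U n] of [y], choose [s n.+1] in the component of [s n]
    over [U n]; this component covers the trace of [D] on [U n], and [D] meets [U n.+1]. The
    components so obtained are coherent, and completeness yields a point in all of them, which lies
    over [y]. *)
Lemma complete_surjective (X Y : topologicalType) (p : X -> Y) (D : set Y) :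
  continuous p -> locally_connected X -> locally_connected Y ->
  hausdorff_space Y -> first_countable Y -> connected [set: Y] ->
  complete p -> portly D -> D `<=` ordinary p -> dense (p @^-1` D) ->
  [set: X] !=set0 -> range p = [set: Y].
Proof.
move=> cp lX lY hY fY cY compl [oD dD cD] DO dpD X0.
have step V x : open V -> connected V -> V (p x) ->
    V `&` D `<=` p @` connected_component (p @^-1` V) x.
  move=> oV cV Vx; have [||x' [x'C Dx']] := dpD (connected_component (p @^-1` V) x).
  - by exists x; exact: connected_component_refl.
  - by apply: component_open => //; move/continuousP : cp; exact.
  rewrite (same_connected_component x'C); apply: component_image => //.
    exact: cD.
  exact: connected_component_sub x'C.
apply/seteqP; split => // y _.
have [U [yU decU baseU]] := conn_nbhs_sequence y fY lY.
have [x0 _] := X0.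
have next n (V : set Y) x : open V -> connected V -> V (p x) -> U n `<=` V ->
    exists x', connected_component (p @^-1` V) x x' /\ U n (p x').
  move=> oV cV Vx UV; have [oU cU Uy] := yU n.
  have [||z [Uz Dz]] := dD (U n); [by exists y|by []|].
  have [x' x'C e] := step V x oV cV Vx z (conj (UV _ Uz) Dz).
  by exists x'; rewrite e.
have [x1 [_ Ux1]] := next 0%N setT x0 openT cY I (fun _ _ => I).
pose nx n x := xget x0 [set x' | connected_component (p @^-1` U n) x x' /\
  U n.+1 (p x')].
pose s := fix s n := if n is m.+1 then nx m (s m) else x1.
have nxP n x : U n (p x) ->
    connected_component (p @^-1` U n) x (nx n x) /\ U n.+1 (p (nx n x)).
  move=> Ux; have [oU cU _] := yU n; rewrite /nx; case: xgetP => [z _ []//|].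
  by have [x' h /(_ x')] := next n.+1 _ x oU cU Ux (decU n).
have sU n : U n (p (s n)) by elim: n => //= n /nxP [].
have decU' m n : (m <= n)%N -> U n `<=` U m.
  move=> /subnK <-; elim: (n - m)%N => //= k IH.
  by apply: subset_trans IH; exact: decU.
have sC n k : connected_component (p @^-1` U n) (s n) (s (n + k)%N).
  elim: k => [|k IH]; first by rewrite addn0; exact: connected_component_refl.
  apply: connected_component_trans IH _; rewrite addnS /=.
  have [] := nxP (n + k)%N (s (n + k)%N) (sU _); move=> + _.
  apply: sub_connected_component; apply: preimage_subset.
  by apply: decU'; exact: leq_addr.
have nE V : exists n, conn_open_nbhs y V -> U n `<=` V.
  have [[oV cV Vy]|] := pselect (conn_open_nbhs y V); last by exists 0%N.
  by have [|n] := baseU V; [exact: open_nbhs_nbhs|exists n].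
have [N NP] := choice nE.
(* For a general [V] the component is read off at an index [N V] with [U (N V)] inside [V]; later
   indices give the same component, which makes the family monotone. *)
have sCV V n : conn_open_nbhs y V -> (N V <= n)%N ->
    connected_component (p @^-1` V) (s (N V)) (s n).
  move=> /NP NV /subnKC <-; apply: sub_connected_component (sC _ _).
  exact: preimage_subset.
have [|||x xchi] :=
    compl y (fun V => connected_component (p @^-1` V) (s (N V))).
- move=> B; rewrite nbhsE => -[B' [oB' B'y] B'B].
  have [||z [B'z Dz]] := dD B'; [by exists y|by []|].
  have [x' _ e] := step setT x0 openT cY I z (conj I Dz).
  by exists z; split; [exists x'|exact: B'B].
- by move=> V yV; exists (s (N V)) => //; apply: NP.
- move=> V V' yV yV' VV'.
  have := sCV V' (maxn (N V) (N V')) yV' (leq_maxr _ _).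
  move/same_connected_component ->.
  have := sCV V (maxn (N V) (N V')) yV (leq_maxl _ _).
  move/same_connected_component ->.
  by apply: sub_connected_component; exact: preimage_subset.
exists x => //; apply/esym/hausdorff_conn_nbhs => // V yV.
by have := xchi V yV => /connected_component_sub.
Qed.

Section spreads.
Context (X Y : topologicalType) (p : X -> Y).

(** A basic open set is a finite intersection of components over sets [u C]; any connected open
    neighbourhood inside all the [u C] works. *)
Lemma spread_nbhs (x : X) (O : set X) :
  locally_connected Y -> spread p -> nbhs x O ->
  exists2 U, conn_open_nbhs (p x) U & connected_component (p @^-1` U) x `<=` O.
Proof.
move=> lY [_ genp]; rewrite nbhsE => -[Q [oQ Qx] QO].
move: oQ; rewrite genp => -[F Fsub QE].
move: Qx; rewrite -QE => -[A FA Ax].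
have [D' D'sub AE] := Fsub A FA.
have H C : exists u, C \in D' -> nbhs (p x) u /\
    connected_component (p @^-1` u) x `<=` C.
  have [CD'|] := boolP (C \in D'); last by exists setT.
  have /D'sub := CD'; rewrite inE => -[u oU CC]; exists u => _.
  have Cx : C x by move: Ax; rewrite -AE; apply.
  have [_ /(_ _ Cx) [ux <-]] := componentsP CC; split => //.
  exact: open_nbhs_nbhs.
have [u uP] := choice H.
have [|V [oV cV Vx VU]] := lY (p x) (\bigcap_(C in [set` D']) u C).
  by apply: filter_bigI => C /uP [].
exists V => //; apply: subset_trans QO; rewrite -QE.
apply: subset_trans (bigcup_sup FA); rewrite -AE => z zC C CD'.
have [_] := uP C CD'; apply; apply: sub_connected_component zC.
by move=> w /VU; exact.
Qed.

Lemma spreadP : continuous p -> locally_connected X ->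
  (forall x O, nbhs x O -> exists U, [/\ open U, U (p x) &
    connected_component (p @^-1` U) x `<=` O]) ->
  spread p.
Proof.
move=> cp lX H; split => //.
set B := \bigcup_(U in open) _.
have oB A : B A -> open A.
  move=> [U oU [x Ux <-]]; apply: component_open => //.
  by move/continuousP: cp; exact.
apply/seteqP; split => [Q oQ|_ [F Fsub <-]].
  exists [set A | B A /\ A `<=` Q].
    by move=> A [BA _]; exact: (finI_from1 id).
  apply/seteqP; split => [x [A [_ AQ] Ax]|x Qx]; first exact: AQ.
  have [|U [oU Ux UO]] := H x Q; first exact: open_nbhs_nbhs.
  exists (connected_component (p @^-1` U) x); last exact: connected_component_refl.
  by split => //; exists U => //; exists x.
apply: bigcup_open => A /Fsub [D' D'sub <-].
rewrite openE => x Ax; apply: filter_bigI => C CD'.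
have /D'sub := CD'; rewrite inE => BC; apply: open_nbhs_nbhs; split.
  exact: oB.
exact: Ax.
Qed.

End spreads.

(** * Maps between branched coverings *)

(** On the ordinary locus, a small sheet over [W] contains a homeomorphic copy of the connected
    trace of [D] on [W]. As the ordinary locus is itself portly, [dense_locally_connected] passes
    from sheets to an arbitrary connected open [Q]. *)
Lemma portly_preimage (X Y : topologicalType) (p : X -> Y) (D : set Y) :
  spread p -> locally_connected X -> locally_connected Y ->
  portly (ordinary_total p) -> portly D -> D `<=` ordinary p ->
  portly (p @^-1` D).
Proof.
move=> sp lX lY [oX dX cX] [oD dD cD] DO.
have [cp _] := sp.
have sheet x Q : nbhs x Q -> ordinary p (p x) ->
    exists W, [/\ conn_open_nbhs (p x) W, evenly_covered p W &
      connected_component (p @^-1` W) x `<=` Q].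
  move=> xQ Ox; have [U [oU cU Ux] UQ] := spread_nbhs lY sp xQ.
  have [|W [xW WU ev]] := ordinary_nbhs (O := U) lY Ox.
    exact: open_nbhs_nbhs.
  exists W; split => //; apply: subset_trans UQ.
  by apply: sub_connected_component; exact: preimage_subset.
have opre U : open U -> open (p @^-1` U) by move/continuousP: cp; exact.
have dpD : dense (p @^-1` D).
  move=> Q Q0 oQ; have [x [Qx Ox]] := dX Q Q0 oQ.
  have [|W [[oW cW Wx] ev CQ]] := sheet x Q _ Ox; first exact: open_nbhs_nbhs.
  have [||y [Wy Dy]] := dD W; [by exists (p x)|by []|].
  have [x' Cx' e] := evenly_covered_surj ev Wx Wy.
  by exists x'; split; [exact: CQ|rewrite /preimage /= e].
split => // [|Q oQ cQ]; first exact: opre.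
have -> : Q `&` p @^-1` D = (Q `&` ordinary_total p) `&` p @^-1` D.
  apply/seteqP; split=> x; last by move=> [[]].
  by move=> [Qx Dx]; split => //; split => //; exact: DO.
apply: dense_locally_connected => //; [exact: openI|exact: cX|].
move=> x [Qx Ox].
have [|W [[oW cW Wx] ev CQ]] := sheet x (Q `&` ordinary_total p) _ Ox.
  by apply: open_nbhs_nbhs; split => //; exact: openI.
exists (connected_component (p @^-1` W) x); split => //.
  apply: open_nbhs_nbhs; split; last exact: connected_component_refl.
  by apply: component_open => //; exact: opre.
have [g [cg gW gp pg]] := evenly_covered_section ev Wx.
suff <- : g @` (W `&` D) = connected_component (p @^-1` W) x `&` p @^-1` D.
  apply: connected_continuous_connected; first exact: cD.
  exact: continuous_subspaceW cg.
apply/seteqP; split => [_ [y [Wy Dy] <-]|x' [Cx' Dx']].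
  by split; [rewrite -gW; exists y|rewrite /preimage /= pg].
by exists (p x'); [split => //; exact: connected_component_sub Cx'|exact: gp].
Qed.

Section morphisms.
Context (R : realType) (Y : topologicalType) (S : set Y).
Hypothesis skelS : skeletal S.

Section facts.
Context (X : topologicalType) (p : X -> Y).
Hypothesis cov : covering_branched_over R S p.

Lemma covering_lc : locally_connected X /\ locally_connected Y.
Proof.
have [[[[_ lX _] [_ lY _]] _ _ _ _] _] := cov.
by split; apply: locally_path_connectedW; eassumption.
Qed.

Lemma covering_ordinary : ~` S `<=` ordinary p.
Proof.
by have [_ /subsetC] := cov; rewrite setCK.
Qed.

Lemma covering_portly : portly (p @^-1` (~` S)).
Proof.
have [lX lY] := covering_lc; have [[_ _ [sp _] _ [pX pY]] _] := cov.
exact: portly_preimage covering_ordinary.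
Qed.

End facts.

(** Agreement is locally constant on [D] by even covering; density and the Hausdorff property extend
    it to all of [Z]. *)
Lemma lift_unique (Z X : topologicalType) (p : X -> Y) (f g : Z -> X)
    (D : set Z) (z : Z) :
  covering_branched_over R S p ->
  continuous f -> continuous g -> p \o f = p \o g ->
  connected D -> dense D -> D `<=` (p \o f) @^-1` (~` S) ->
  D z -> f z = g z -> f = g.
Proof.
move=> cov cf cg e cD dD DS Dz fg.
have [lX lY] := covering_lc cov; have [[[[hX _ _] _] _ [[cp _] _] _ _] _] := cov.
have hD : D `<=` [set z | f z = g z].
  apply: (locally_constant_connected cD Dz) => // y Dy.
  have [U [oU Uy ev]] := covering_ordinary cov (DS y Dy).
  have oC x : open (connected_component (p @^-1` U) x).
    by apply: component_open => //; move/continuousP: cp; exact.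
  have nC h : continuous h -> p (h y) = p (f y) ->
      nbhs y (h @^-1` (connected_component (p @^-1` U) (h y))).
    move=> ch eh; apply: ch; apply: open_nbhs_nbhs; split; first exact: oC.
    by apply: connected_component_refl; rewrite /preimage /= eh.
  have eg : p (g y) = p (f y) by have := congr1 (@^~ y) e.
  apply: filterS2 (nC f cf erefl) (nC g cg eg) => z' fz' gz' Dz'.
  have ez' : p (f z') = p (g z') := congr1 (@^~ z') e.
  split=> efg.
    rewrite -efg in gz'; exact: evenly_covered_inj fz' gz' ez'.
  have {}fz' := connected_component_sym fz'.
  have {}gz' := connected_component_sym gz'.
  rewrite -efg in gz'; exact: evenly_covered_inj fz' gz' (esym eg).
apply/funext => y; apply: hX => A B fA gB.
have yAB : nbhs y (f @^-1` A `&` g @^-1` B).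
  by apply: filterI; [exact: cf|exact: cg].
move: yAB; rewrite nbhsE => -[N [oN Ny] NAB].
have [||w [Nw Dw]] := dD N; [by exists y|by []|].
have [Aw Bw] := NAB w Nw.
by exists (f w); split => //; rewrite (hD _ Dw).
Qed.

Section factor.
Context (X1 X2 : topologicalType) (p1 : X1 -> Y) (p2 : X2 -> Y) (q : X1 -> X2).
Hypothesis (cov1 : covering_branched_over R S p1)
           (cov2 : covering_branched_over R S p2).
Hypothesis (cq : continuous q) (pq : p2 \o q = p1).

Let pqE x : p2 (q x) = p1 x. Proof. by rewrite -pq. Qed.

(** [q] maps a component of [p1] over [U] into a single component of [p2] over [U]. This identity of
    components is how the properties of [p1] pass to [q]. *)
Lemma component_factor (U : set Y) (x2 : X2) (x1 : X1) :
  connected_component (p2 @^-1` U) x2 (q x1) ->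
  connected_component (q @^-1` connected_component (p2 @^-1` U) x2) x1 =
  connected_component (p1 @^-1` U) x1.
Proof.
move=> Cq; apply/seteqP; split.
  apply: sub_connected_component => z /connected_component_sub.
  by rewrite /preimage /= pqE.
apply: connected_component_max.
- apply: connected_component_refl; have := connected_component_sub Cq.
  by rewrite /preimage /= pqE.
- move=> z Cz; apply: (connected_component_trans Cq).
  exists (q @` connected_component (p1 @^-1` U) x1); last by exists z.
  split.
  + exists x1 => //; apply: connected_component_refl.
    by have := connected_component_sub Cq; rewrite /preimage /= pqE.
  + move=> _ [w /connected_component_sub + <-].
    by rewrite /preimage /= pqE.
  + apply: connected_continuous_connected; first exact: component_connected.
    exact: continuous_subspaceT.
- exact: component_connected.
Qed.

Lemma factor_spread : spread q.
Proof.
have [lX1 lY] := covering_lc cov1; have [lX2 _] := covering_lc cov2.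
have [[_ _ [sp1 _] _ _] _] := cov1; have [[_ _ [[cp2 _] _] _ _] _] := cov2.
apply: spreadP => // x Q xQ.
have [U [oU cU Ux] UQ] := spread_nbhs lY sp1 xQ.
exists (p2 @^-1` U); split; first by move/continuousP: cp2; exact.
  by rewrite /preimage /= pqE.
by rewrite -[q @^-1` _]/((p2 \o q) @^-1` U) pq.
Qed.

(** A coherent family for [q] at [x2], restricted to the sets [V U], is one for [p1] at [p2 x2]. As
    [p2] is a spread, the sets [V U] form a neighbourhood base at [x2], so the point found for [p1]
    lies in the whole family. *)
Lemma factor_complete : complete q.
Proof.
have [lX1 lY] := covering_lc cov1; have [lX2 _] := covering_lc cov2.
have [[[_ [hY _ _]] _ [sp1 comp1] sur1 _] _] := cov1.
have [[[[hX2 _ _] _] _ [sp2 _] _ _] _] := cov2.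
have [cp2 _] := sp2.
move=> x2 chi _ chiC chiM.
pose V U := connected_component (p2 @^-1` U) x2.
have VP U : conn_open_nbhs (p2 x2) U -> conn_open_nbhs x2 (V U).
  move=> [oU cU Ux]; split; last exact: connected_component_refl.
    by apply: component_open => //; move/continuousP : cp2; exact.
  exact: component_connected.
have [|||x1 x1chi] := comp1 (p2 x2) (fun U => chi (V U)).
- by rewrite sur1; apply: subset_closure.
- move=> U xU; have [x1 qx1 <-] := chiC _ (VP U xU).
  exists x1; last by rewrite /V component_factor.
  by have := connected_component_sub qx1; rewrite /preimage /= pqE.
- move=> U U' xU xU' UU'; apply: chiM; [exact: VP|exact: VP|].
  by apply: sub_connected_component; exact: preimage_subset.
exists x1 => Q [oQ cQ Qx].
have [|U xU UQ] := spread_nbhs (O := Q) lY sp2 (x := x2).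
  exact: open_nbhs_nbhs.
by apply: (chiM (V U)) => //; [exact: VP|exact: x1chi].
Qed.

Lemma factor_ordinary : p2 @^-1` (~` S) `<=` ordinary q.
Proof.
move=> x2 Sx2; have [lX1 lY] := covering_lc cov1.
have [lX2 _] := covering_lc cov2.
have [[_ _ [[cp1 _] _] _ _] _] := cov1; have [[_ _ [[cp2 _] _] _ _] _] := cov2.
have [W1 [[oW1 cW1 W1x] _ ev1]] :=
  ordinary_nbhs lY (covering_ordinary cov1 Sx2) filterT.
have [|W [[oW cW Wx] WW1 ev2]] :=
    ordinary_nbhs (O := W1) lY (covering_ordinary cov2 Sx2).
  exact: open_nbhs_nbhs.
have {}ev1 := evenly_covered_sub ev1 cW WW1.
exists (connected_component (p2 @^-1` W) x2); split.
- by apply: component_open => //; move/continuousP: cp2; exact.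
- exact: connected_component_refl.
move=> C [x1 qx1 <-]; rewrite component_factor //.
have [g2 [cg2 g2W g2p pg2]] := evenly_covered_section ev2 Wx.
have Wx1 : W (p1 x1).
  by have := connected_component_sub qx1; rewrite /preimage /= pqE.
have [g1 [cg1 g1W g1p pg1]] := evenly_covered_section ev1 Wx1.
have qC z : connected_component (p1 @^-1` W) x1 z ->
    connected_component (p2 @^-1` W) x2 (q z).
  by rewrite -(component_factor qx1) => /connected_component_sub.
have g1C y : W y -> connected_component (p1 @^-1` W) x1 (g1 y).
  by move=> Wy; rewrite -g1W; exists y.
split; first exact: continuous_subspaceT.
split.
  apply/seteqP; split => [_ [z /qC ? <-]//|z Cz].
  have Wz := connected_component_sub Cz.
  exists (g1 (p2 z)); first exact: g1C.
  apply: evenly_covered_inj ev2 (qC _ (g1C _ Wz)) Cz _.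
  by rewrite pqE pg1.
(* The inverse of [q] on this component: project to [Y], then lift by the section of [p1]. *)
exists (g1 \o p2); split.
- apply: within_continuous_compS cg1 _; first exact: continuous_subspaceT.
  by move=> _ [z /connected_component_sub ? <-].
- apply/seteqP; split => [_ [z Cz <-]|z Cz].
    by apply: g1C; exact: connected_component_sub Cz.
  by exists (q z); [exact: qC|rewrite /= pqE g1p].
by move=> z Cz; rewrite /= pqE g1p.
Qed.

(** Surjectivity of [q] comes from its completeness by [complete_surjective], which asks for a point
    of [X1]; surjectivity of [p1] provides one from a point of [X2]. *)
Lemma factor_covering : covering_branched_over R (p2 @^-1` S) q.
Proof.
have [lX1 lY] := covering_lc cov1; have [lX2 _] := covering_lc cov2.
have [[[aX1 _] [cX1 _] _ sur1 _] _] := cov1.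
have [[[aX2 _] [cX2 _] _ _ _] _] := cov2.
have oD := factor_ordinary.
have ptl2 := covering_portly cov2; have [_ d1 _] := covering_portly cov1.
have d1' : dense (q @^-1` (p2 @^-1` ~` S)) by rewrite -comp_preimage pq.
have sq := factor_spread.
have po : portly (ordinary q).
  by apply: portly_sup ptl2 _ _ => //; exact: ordinary_open.
split; last by rewrite /branching_locus -[X in _ `<=` X]setCK; exact: subsetC.
split => //.
- by split => //; exact: factor_complete.
- have [hX2 _ fX2] := aX2.
  have [X20|/set0P[x2 _]] := eqVneq [set: X2] set0.
    by apply/seteqP; split => // x _; have : [set: X2] x by []; rewrite X20.
  apply: (complete_surjective cq lX1 lX2 hX2 fX2 cX2 factor_complete ptl2) => //.
  have : range p1 (p2 x2) by rewrite sur1.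
  by case=> x1 _ _; exists x1.
split => //; apply: portly_sup (covering_portly cov1) _ _.
  by move/continuousP : cq; apply; exact: ordinary_open.
by move=> x Sx; apply: oD; rewrite /preimage /= pqE.
Qed.

End factor.
End morphisms.

(** * From the pointed universal property to maximality and uniqueness *)

Section universal.
Context (R : realType) (Y : topologicalType) (S : set Y).
Hypothesis skelS : skeletal S.
Context (T : topologicalType) (pi : T -> Y).
Hypothesis cov : covering_branched_over R S pi.

Lemma universal_endo (t0 : T) :
  ~ S (pi t0) ->
  (forall (X : topologicalType) (p : X -> Y) (x : X),
    covering_branched_over R S p -> p x = pi t0 ->
    exists q : T -> X, [/\ continuous q, p \o q = pi & q t0 = x]) ->
  forall f : T -> T, continuous f -> pi \o f = pi ->
  exists g : T -> T, [/\ continuous g, cancel f g & cancel g f].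
Proof.
move=> St0 univ f cf pf.
have surj (h : T -> T) : continuous h -> pi \o h = pi ->
    forall z, exists y, h y = z.
  move=> ch ph z; have [[_ _ _ sur _] _] := factor_covering skelS cov cov ch ph.
  have : range h z by rewrite sur.
  by case=> y _ <-; exists y.
(* Any [g] sending [t0] to a preimage of [t0] under [f] is a section of [f]; as
   an endomorphism, [g] is surjective too, so it is the inverse of [f]. *)
have [z fz] := surj f cf pf t0.
have [|g [cg pg gt0]] := univ _ _ z cov; first by rewrite -fz -{1}pf.
have [_ dD cD] := covering_portly skelS cov.
have {}cD : connected (pi @^-1` (~` S)).
  rewrite -[X in connected X]setTI; apply: cD; first exact: openT.
  by have [[_ []]] := cov.
have fg : f \o g = id.
  apply: (lift_unique (p := pi) (D := pi @^-1` (~` S)) (z := t0) cov) => //.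
  - by move=> t; apply: continuous_comp; [exact: cg|exact: cf].
  - by move=> t; exact: cvg_id.
  - by rewrite compA pf pg.
  - by rewrite -[pi \o _]/((pi \o f) \o g) pf pg.
  - by rewrite /= gt0.
have {}fg : cancel g f by move=> t; rewrite -[LHS]/((f \o g) t) fg.
exists g; split => // t; have [y <-] := surj g cg pg t.
by rewrite fg.
Qed.

(** For a maximal [r], the universal map [q] shows that [pi] is larger, so maximality returns a map
    [h] in the other direction. The endomorphism [h \o q] has an inverse [g], and surjectivity of
    [q] makes [q \o g] a two-sided inverse of [h]. *)
Lemma universal_conclusion :
  (forall (X : topologicalType) (p : X -> Y), covering_branched_over R S p ->
    exists2 q : T -> X, continuous q & p \o q = pi) ->
  (forall f : T -> T, continuous f -> pi \o f = pi ->
    exists g : T -> T, [/\ continuous g, cancel f g & cancel g f]) ->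
  [/\ maximal_branched_over R S pi,
      forall (Z : topologicalType) (r : Z -> Y),
        maximal_branched_over R S r -> isomorphic_over r pi &
      forall (X : topologicalType) (p : X -> Y),
        covering_branched_over R S p ->
        exists2 q : T -> X,
          covering_branched_over R (p @^-1` S) q & p \o q = pi].
Proof.
move=> univ endo.
have fact (X : topologicalType) (p : X -> Y) : covering_branched_over R S p ->
    exists2 q : T -> X, covering_branched_over R (p @^-1` S) q & p \o q = pi.
  move=> covp; have [q cq pq] := univ _ _ covp; exists q => //.
  exact: (factor_covering skelS cov covp cq pq).
split; [|move=> Z r [covr maxr]|exact: fact].
  by split=> [//|X p covp _]; have [q [bq _] pq] := fact _ _ covp; exists q.
have [q [bq _] rq] := fact _ _ covr.
have [|h bh hr] := maxr _ _ cov; first by exists q.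
have [_ _ [[cq _] _] surq _] := bq.
have [_ _ [[ch _] _] _ _] := bh.
have chq : continuous (h \o q).
  by move=> t; apply: continuous_comp; [exact: cq|exact: ch].
have [|g [cg hqg ghq]] := endo _ chq; first by rewrite compA hr.
exists h => //; split => //; exists (q \o g); split.
- by move=> t; apply: continuous_comp; [exact: cg|exact: cq].
- move=> z; have : range q z by rewrite surq.
  by case=> t _ <- /=; congr q; exact: hqg.
exact: ghq.
Qed.

End universal.

(** The empty space counts as connected here and offers no base point for chains, so it gets a
    covering of its own. *)
Lemma empty_covering (R : realType) (Y : topologicalType) (S : set Y) :
  (Y -> False) -> admissible_space R Y -> covering_branched_over R S (@id Y).
Proof.
move=> Y0 aY.
have e (A B : set Y) : A = B by apply/seteqP; split=> y; case: (Y0 y).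
have pY (D : set Y) : portly D.
  split; [by rewrite (e D set0); exact: open0|by move=> A [y]; case: (Y0 y)|].
  by move=> U _ _; rewrite (e (_ `&` _) set0); exact: connected0.
split; last by move=> y; case: (Y0 y).
split => //.
- by rewrite (e setT set0); split; exact: connected0.
- split; last by move=> y; case: (Y0 y).
  split; first by move=> y; case: (Y0 y).
  apply/seteqP; split => A _.
    by exists set0; [move=> ?|exact: e].
  by rewrite (e A set0); exact: open0.
Qed.

(** * Null-homotopic loops lift to loops *)

Lemma square_lebesgue_number (R : realType) (Y : topologicalType)
    (H : R * R -> Y) (P : set (set Y)) :
  {within `[0, 1] `*` `[0, 1], continuous H} ->
  (forall b : R * R, (`[0, 1] `*` `[0, 1]) b ->
    exists W, [/\ P W, open W & W (H b)]) ->
  exists n, forall b : R * R, (`[0, 1] `*` `[0, 1]) b ->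
    exists2 W, P W & forall b' : R * R, (`[0, 1] `*` `[0, 1]) b' ->
      ball b (n.+1%:R^-1 : R) b' -> W (H b').
Proof.
set Q := `[0, 1] `*` `[0, 1].
move=> /subspace_continuousP cH HP.
have : compact Q by apply: compact_setX; exact: segment_compact.
move=> /compact_near_coveringP /(_ nat \oo (fun n (b : R * R) =>
  exists2 W, P W & forall b' : R * R,
    Q b' -> ball b (n.+1%:R^-1 : R) b' -> W (H b'))) [] //; last first.
  by move=> n _ hn; exists n => b /(hn n (leqnn n)).
move=> b Qb; have [W [PW oW Wb]] := HP b Qb.
have : nbhs b (fun b' => Q b' -> W (H b')).
  by apply: (cH b Qb); apply: open_nbhs_nbhs.
move=> /nbhs_ballP [e /= e0 eW].
(* Half of the radius is left for the ball of radius [n.+1%:R^-1] around a nearby centre. *)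
have e2 : 0 < e / 2 by lra.
near=> b' n.
have bb' : ball b (e / 2) b' by near: b'; exact: nbhsx_ballx.
have ne : n.+1%:R^-1 < e / 2.
  by near: n; exact: (near_infty_natSinv_lt (PosNum e2)).
exists W => // b'' Qb'' bb''; apply: eW => //.
by apply: (ball_split bb'); apply: le_ball bb''; exact: ltW.
Unshelve. all: by end_near. Qed.

Lemma pair_continuousl (U V : topologicalType) (v : V) :
  continuous (fun u : U => (u, v)).
Proof.
move=> u P [[A B] [/= uA vB] AB]; apply: filterS uA => x Ax.
by apply: (AB (x, v)); split => //=; exact: nbhs_singleton.
Qed.

Lemma pair_continuousr (U V : topologicalType) (u : U) :
  continuous (fun v : V => (u, v)).
Proof.
move=> v P [[A B] [/= uA vB] AB]; apply: filterS vB => x Bx.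
by apply: (AB (u, x)); split => //=; exact: nbhs_singleton.
Qed.

(* [H] contracts the projection of the path [g].  Lift the [j]-th column of a
   fine grid of the square to points [xs j k], starting from [g 0]; within each
   cell the lifts of neighbouring columns stay in one component.  Column [0]
   follows [g], and the last column is constant. *)
Lemma null_homotopic_lift (R : realType) (X Y : topologicalType) (p : X -> Y)
    (H : R * R -> Y) (g : R -> X) :
  locally_connected Y ->
  {within `[0, 1] `*` `[0, 1], continuous H} ->
  (forall b : R * R, (`[0, 1] `*` `[0, 1]) b -> ordinary p (H b)) ->
  {within `[0, 1], continuous g} ->
  (forall t, `[0, 1]%classic t -> H (0, t) = p (g t)) ->
  (forall t, `[0, 1]%classic t -> H (1, t) = p (g 0)) ->
  (forall s, `[0, 1]%classic s -> H (s, 0) = p (g 0) /\ H (s, 1) = p (g 0)) ->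
  g 0 = g 1.
Proof.
move=> lY cH oH cg Hg H1 H01.
have [m mP] := square_lebesgue_number (P := evenly_covered p) cH
  (fun b Qb => let: ex_intro W (And3 oW Wb eW) := oH b Qb in
    ex_intro _ W (And3 eW oW Wb)).
(* The mesh [1 / N] is strictly below the Lebesgue number [1 / m.+1], so a closed cell lies in the
   open ball around its corner. *)
pose N := m.+2; pose u (j : nat) : R := j%:R / N%:R.
have N0 : 0 < N%:R :> R by rewrite ltr0n.
have u0 : u 0%N = 0 by rewrite /u mul0r.
have uN : u N = 1 by rewrite /u divff // gt_eqF.
have uI j : (j <= N)%N -> `[0, 1]%classic (u j).
  move=> jN; rewrite /= in_itv /= /u divr_ge0 //= ler_pdivrMr // mul1r.
  by rewrite ler_nat.
have uS j : u j <= u j.+1 by rewrite /u ler_pM2r ?invr_gt0 // ler_nat.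
have seg j s : (j < N)%N -> `[u j, u j.+1]%classic s ->
    `[0, 1]%classic s /\ ball (u j) (m.+1%:R^-1 : R) s.
  move=> jN; rewrite /= !in_itv /= => /andP[js sj].
  have /= := uI j (ltnW jN); rewrite in_itv /= => /andP[j0 _].
  have /= := uI j.+1 jN; rewrite in_itv /= => /andP[_ j1].
  split; first by rewrite (le_trans j0 js) (le_trans sj j1).
  rewrite /ball /= distrC ger0_norm ?subr_ge0 //.
  apply: (@le_lt_trans _ _ N%:R^-1).
    have -> : N%:R^-1 = u j.+1 - u j :> R.
      by rewrite /u -mulrBl -natrB // subSnn mul1r.
    by rewrite lerB.
  by rewrite ltf_pV2 ?posrE // ltr_nat.
pose ver j k := (fun t => H (u j, t)) @` `[u k, u k.+1].
pose hor j k := (fun s => H (s, u k)) @` `[u j, u j.+1].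
have b0 j : ball (u j) (m.+1%:R^-1 : R) (u j) by exact: ballxx.
have prodball (a b s t : R) : ball a (m.+1%:R^-1 : R) s ->
    ball b (m.+1%:R^-1 : R) t -> ball (a, b) (m.+1%:R^-1 : R) (s, t).
  by move=> h1 h2; exact: (conj h1 h2).
have uu j : `[u j, u j.+1]%classic (u j) by rewrite /= in_itv /= lexx uS.
have uuS j : `[u j, u j.+1]%classic (u j.+1) by rewrite /= in_itv /= lexx uS.
have cver j k : (j <= N)%N -> (k < N)%N -> connected (ver j k).
  move=> jN kN; apply: connected_continuous_connected.
    exact: segment_connected.
  have cj : {within `[u k, u k.+1], continuous (fun t : R => (u j, t))}.
    exact/continuous_subspaceT/pair_continuousr.
  apply: (within_continuous_compS cj cH) => _ [t /(seg k t kN) [t1 _] <-].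
  by split => //; exact: uI.
have chor j k : (j < N)%N -> (k <= N)%N -> connected (hor j k).
  move=> jN kN; apply: connected_continuous_connected.
    exact: segment_connected.
  have cj : {within `[u j, u j.+1], continuous (fun s : R => (s, u k))}.
    exact/continuous_subspaceT/pair_continuousl.
  apply: (within_continuous_compS cj cH) => _ [t /(seg j t jN) [t1 _] <-].
  by split => //; exact: uI.
have evver j k : (j <= N)%N -> (k < N)%N -> evenly_covered p (ver j k).
  move=> jN kN; have [|W eW HW] := mP (u j, u k).
    by split; apply: uI => //; exact: ltnW.
  apply: (evenly_covered_sub eW); first exact: cver.
  move=> _ [t /(seg k t kN) [t1 bt] <-]; apply: HW; last exact: prodball.
  by split => //; exact: uI.
have evhor j k : (j < N)%N -> (k <= N)%N -> evenly_covered p (hor j k).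
  move=> jN kN; have [|W eW HW] := mP (u j, u k).
    by split; apply: uI => //; exact: ltnW.
  apply: (evenly_covered_sub eW); first exact: chor.
  move=> _ [t /(seg j t jN) [t1 bt] <-]; apply: HW; last exact: prodball.
  by split => //; exact: uI.
have cell j k : (j < N)%N -> (k < N)%N -> exists W, [/\ evenly_covered p W,
    hor j k `<=` W /\ hor j k.+1 `<=` W & ver j k `<=` W /\ ver j.+1 k `<=` W].
  move=> jN kN; have [|W eW HW] := mP (u j, u k).
    by split; apply: uI => //; exact: ltnW.
  have HW' s t : `[u j, u j.+1]%classic s -> `[u k, u k.+1]%classic t ->
      W (H (s, t)).
    move=> /(seg j s jN) [s1 bs] /(seg k t kN) [t1 bt].
    by apply: HW; [|exact: prodball].
  by exists W; split => //; split => _ [s ? <-]; apply: HW' => //;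
    first [exact: uu|exact: uuS].
have verl j k : ver j k (H (u j, u k)) by exists (u k).
have verr j k : ver j k (H (u j, u k.+1)) by exists (u k.+1).
have horl j k : hor j k (H (u j, u k)) by exists (u j).
have horr j k : hor j k (H (u j.+1, u k)) by exists (u j.+1).
pose nx j k x := xget (g 0) [set x' |
  connected_component (p @^-1` ver j k) x x' /\ p x' = H (u j, u k.+1)].
pose xs j := fix xs k := if k is k'.+1 then nx j k' (xs k') else g 0.
have nxP j k x : (j <= N)%N -> (k < N)%N -> p x = H (u j, u k) ->
    connected_component (p @^-1` ver j k) x (nx j k x) /\
    p (nx j k x) = H (u j, u k.+1).
  move=> jN kN px; rewrite /nx; case: xgetP => [//|h].
  have [|x' xx' px'] :=
    evenly_covered_surj (p := p) (x := x) (evver j k jN kN) _ (verr j k).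
    by rewrite px; exact: verl.
  by case: (h x').
have xsP j k : (j <= N)%N -> (k <= N)%N -> p (xs j k) = H (u j, u k).
  move=> jN; elim: k => [_|k IH kN] /=.
    by rewrite u0; have [<-] := H01 _ (uI j jN).
  by have [] := nxP j k (xs j k) jN kN (IH (ltnW kN)).
have xsC j k : (j <= N)%N -> (k < N)%N ->
    connected_component (p @^-1` ver j k) (xs j k) (xs j k.+1).
  by move=> jN kN; have [] := nxP j k (xs j k) jN kN (xsP j k jN (ltnW kN)).
have xs0 k : (k <= N)%N -> xs 0%N k = g (u k).
  elim: k => [_|k IH kN]; first by rewrite u0.
  apply: (evenly_covered_inj (evver 0%N k _ kN) (xsC 0%N k _ kN)) => //.
    rewrite IH; last exact: ltnW.
    have sub t : `[u k, u k.+1]%classic t -> `[0, 1]%classic t.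
      by move=> /(seg k t kN) [].
    exists (g @` `[u k, u k.+1]); last by exists (u k.+1).
    split; first by exists (u k).
      move=> _ [t tk <-]; exists t => //; rewrite u0 Hg //.
      exact: sub.
    apply: connected_continuous_connected; first exact: segment_connected.
    exact: continuous_subspaceW cg.
  by rewrite xsP // u0 Hg //; exact: uI.
have xsN k : (k <= N)%N -> xs N k = g 0.
  elim: k => [//|k IH kN].
  apply: (evenly_covered_inj (evver N k _ kN) (xsC N k _ kN)) => //.
    rewrite IH; last exact: ltnW.
    apply: connected_component_refl; rewrite /preimage /=.
    by rewrite -(H1 (u k)); [rewrite -uN; exact: verl|exact/uI/ltnW].
  by rewrite xsP // uN H1 //; exact: uI.
(* The evenly covered sets of adjacent cells are unrelated. The induction on [k] therefore compares
   neighbouring columns over the shared edge [hor j k], which lies in both sets. *)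
have C j k : (j < N)%N -> (k <= N)%N ->
    connected_component (p @^-1` hor j k) (xs j k) (xs j.+1 k).
  move=> jN; elim: k => [_|k IH kN].
    apply: connected_component_refl; rewrite /preimage /=.
    have [<- _] := H01 _ (uI j (ltnW jN)); rewrite -u0; exact: horl.
  have [W [eW [h1 h2] [v1 v2]]] := cell j k jN kN.
  have jN' := ltnW jN.
  have [|x' xx' px'] := evenly_covered_surj (p := p) (x := xs j k.+1)
      (evhor j k.+1 jN kN) _ (horr j k.+1).
    by rewrite xsP //; exact: horl.
  suff -> : xs j.+1 k.+1 = x' by [].
  have sub A x y : A `<=` W -> connected_component (p @^-1` A) x y ->
      connected_component (p @^-1` W) x y.
    by move=> AW; apply: sub_connected_component; exact: preimage_subset.
  apply: (evenly_covered_inj (x := xs j k) eW).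
  - apply: (connected_component_trans (y := xs j.+1 k)).
      exact: sub h1 (IH (ltnW kN)).
    exact: sub v2 (xsC _ _ _ _).
  - apply: (connected_component_trans (y := xs j k.+1)).
      exact: sub v1 (xsC _ _ _ _).
    exact: sub h2 xx'.
  - by rewrite xsP.
(* [H] is constant on the side [t = 1], so the comparison of columns becomes an equality there. *)
have top j : (j <= N)%N -> xs j N = xs 0%N N.
  elim: j => [//|j IH jN]; rewrite -IH; last exact: ltnW.
  apply/esym/(evenly_covered_inj (evhor j N jN (leqnn N)) _ (C j N jN (leqnn N))).
    apply: connected_component_refl; change (hor j N (p (xs j N))).
    by rewrite xsP //; exact: ltnW.
  rewrite !xsP // ?uN; last exact: ltnW.
  by have [_ ->] := H01 _ (uI _ jN); have [_ ->] := H01 _ (uI _ (ltnW jN)).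
by have := top N (leqnn N); rewrite xsN // xs0 // uN.
Qed.

(** * Paths *)

Section paths.
Context (R : realType) (X : topologicalType).
Implicit Types (A : set X) (x y z : X) (g h : R -> X).

Lemma within_eq_continuous (B : set R) g h :
  (forall t, B t -> g t = h t) -> {within B, continuous g} ->
  {within B, continuous h}.
Proof.
by move=> gh; apply: subspace_eq_continuous => t; rewrite inE => /gh.
Qed.

Lemma within_affine_continuous (a b c d e f : R) g :
  {within `[c, d], continuous g} ->
  (forall t, `[e, f]%classic t -> `[c, d]%classic (a * t + b)) ->
  {within `[e, f], continuous (fun t => g (a * t + b))}.
Proof.
move=> cg ef; have ca : {within `[e, f], continuous (fun t : R => a * t + b)}.
  apply: continuous_subspaceT => t.
  by apply: cvgD; [apply: cvgMr; exact: cvg_id|exact: cvg_cst].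
by apply: (within_continuous_compS ca cg) => _ [t /ef ? <-].
Qed.

Lemma path_cst A x : A x -> path_in A x x (fun _ : R => x).
Proof.
move=> Ax; split => //; last by move=> _ [t _ <-].
by apply: continuous_subspaceT => t; exact: cvg_cst.
Qed.

Lemma path_concat A x y z g h :
  path_in A x y g -> path_in A y z h -> exists k : R -> X, path_in A x z k.
Proof.
move=> [cg g0 g1 gA] [ch h0 h1 hA].
pose k t := if t <= 2^-1 then g (2 * t + 0) else h (2 * t + -1).
have kh t : 2^-1 <= t -> k t = h (2 * t + -1).
  rewrite /k le_eqVlt => /orP[/eqP <-|]; last by rewrite ltNge => /negbTE ->.
  rewrite lexx addr0 divff ?pnatr_eq0 //.
  by rewrite subrr g1 h0.
have kg t : t <= 2^-1 -> k t = g (2 * t + 0) by rewrite /k => ->.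
exists k; split.
- have -> : `[0, 1]%classic = `[0, 2^-1] `|` `[2^-1, 1] :> set R.
    apply/seteqP; split => [t|t []]; rewrite /= !in_itv /=.
    + move=> /andP[-> ->]; rewrite andbT; case: (leP t 2^-1); [by left|].
      by move=> /ltW ->; right.
    + by move=> /andP[-> h2]; apply: le_trans h2 _; lra.
    + by move=> /andP[h2 ->]; rewrite andbT; apply: le_trans h2; lra.
  apply: withinU_continuous; [exact: itv_closed|exact: itv_closed| |].
  + apply: within_eq_continuous (within_affine_continuous (a := 2) (b := 0) cg _).
      by move=> t; rewrite /= in_itv /= => /andP[_ /kg].
    by move=> t; rewrite /= !in_itv /= => /andP[? ?]; apply/andP; split; lra.
  + apply: within_eq_continuous (within_affine_continuous (a := 2) (b := -1) ch _).
      by move=> t; rewrite /= in_itv /= => /andP[/kh].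
    by move=> t; rewrite /= !in_itv /= => /andP[? ?]; apply/andP; split; lra.
- by rewrite kg ?invr_ge0 // mulr0 addr0.
- by rewrite kh ?mulr1; [rewrite -h1; congr h; lra|lra].
move=> _ [t /= + <-]; rewrite in_itv /= => /andP[t0 t1].
case: (leP t 2^-1) => [t2|/ltW t2].
  rewrite kg //; apply: gA; exists (2 * t + 0) => //=.
  by rewrite in_itv /=; apply/andP; split; lra.
rewrite kh //; apply: hA; exists (2 * t + -1) => //=.
by rewrite in_itv /=; apply/andP; split; lra.
Qed.

Lemma open_connected_path_connected A :
  locally_path_connected R X -> open A -> connected A -> path_connected R A.
Proof.
move=> lX oA cA x y Ax Ay; move: y Ay.
apply: (locally_constant_connected cA Ax).
  by exists (fun=> x); exact: path_cst.
move=> y Ay; have [|V [oV Vy pV VA]] := lX y A; first exact: open_nbhs_nbhs.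
apply: (@filterS _ _ _ V); last exact: open_nbhs_nbhs.
have sub y1 y2 : V y1 -> V y2 -> (exists g : R -> X, path_in A x y1 g) ->
    exists g : R -> X, path_in A x y2 g.
  move=> V1 V2 [g pg]; have [h [ch h0 h1 hV]] := pV y1 y2 V1 V2.
  apply: path_concat pg _; last first.
    split; [exact: ch|exact: h0|exact: h1|].
    by move=> _ [t ? <-]; apply: VA; apply: hV; exists t.
by move=> z Vz _; split; exact: sub.
Qed.

(** Continuity at [0], where the value is [z], holds because the path stays in [A n] up to time
    [1 / n.+1] and the [A n] shrink to [z]. This is how points of the completion over [S] are
    reached. *)
Lemma path_infinite_concat (A : nat -> set X) z (x : nat -> X) (g : nat -> R -> X) :
  (forall V, nbhs z V -> exists n, A n `<=` V) ->
  (forall n, A n.+1 `<=` A n) -> (forall n, A n z) ->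
  (forall n, path_in (A n) (x n) (x n.+1) (g n)) ->
  exists k : R -> X, path_in (A 0%N) z (x 0%N) k.
Proof.
move=> baseA decA Az pg.
have decA' m n : (m <= n)%N -> A n `<=` A m.
  move=> /subnK <-; elim: (n - m)%N => //= k IH.
  by apply: subset_trans IH; exact: decA.
(* [G] runs through [g n] on [[n, n + 1]]; the path is [t |-> G (1/t - 1)]. *)
pose G u := g (Num.truncn u) (u - (Num.truncn u)%:R).
have Gn n u : n%:R <= u <= n.+1%:R -> G u = g n (1 * u + - n%:R).
  move=> /andP[nu]; rewrite mul1r le_eqVlt => /orP[/eqP ->|un].
    rewrite /G natrK subrr -natrB // subSnn.
    by have [_ -> _ _] := pg n.+1; have [_ _ -> _] := pg n.
  rewrite /G; suff -> : Num.truncn u = n by [].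
  by apply/eqP; rewrite truncn_eq ?nu // (le_trans _ nu).
have GA n u : n%:R <= u -> A n (G u).
  move=> nu; have u0 : 0 <= u by rewrite (le_trans _ nu).
  have /andP[t1 t2] := truncn_itv u0.
  have : (n <= Num.truncn u)%N by by rewrite truncn_ge_nat.
  move=> /decA'; apply; rewrite /G; have [_ _ _] := pg (Num.truncn u); apply.
  exists (u - (Num.truncn u)%:R) => //=; rewrite in_itv /= subr_ge0 t1 /=.
  by move: t2; rewrite -natr1 => t2; lra.
have cG n : {within `[0, n%:R], continuous G}.
  elim: n => [|n IH]; first by rewrite set_itv1; exact: continuous_subspace1.
  have -> : `[0, n.+1%:R]%classic = `[0, n%:R] `|` `[n%:R, n.+1%:R] :> set R.
    have n1 : n%:R <= n.+1%:R :> R by rewrite ler_nat.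
    apply/seteqP; split => [t|t []]; rewrite /= !in_itv /=.
    + move=> /andP[-> ->]; rewrite andbT; case: (leP t n%:R); [by left|].
      by move=> /ltW ->; right.
    + by move=> /andP[-> /le_trans]; apply.
    + by move=> /andP[h2 ->]; rewrite andbT; apply: le_trans h2.
  apply: withinU_continuous IH _; [exact: itv_closed|exact: itv_closed|].
  have [cg _ _ _] := pg n.
  apply: within_eq_continuous (within_affine_continuous (a := 1) (b := - n%:R) cg _).
    by move=> t; rewrite /= in_itv => /Gn.
  by move=> t; rewrite /= !in_itv /= -natr1 => /andP[? ?]; apply/andP; split; lra.
pose k t := if t <= 0 then z else G (t^-1 - 1).
have kG t : 0 < t -> k t = G (t^-1 - 1) by rewrite ltNge /k => /negbTE ->.
have k0 : k 0 = z by rewrite /k lexx.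
have t1 (t : R) : 0 < t -> t <= 1 -> 0 <= t^-1 - 1.
  by move=> t0 tle1; rewrite subr_ge0 -[leLHS]invr1 lef_pV2 ?posrE //.
have kA n t : 0 < t -> t <= n.+1%:R^-1 -> A n (k t).
  move=> t0 tn; rewrite kG //; apply: GA; rewrite lerBrDr natr1.
  by rewrite -[leLHS]invrK lef_pV2 ?posrE ?invr_gt0.
have k1 : k 1 = x 0%N.
  rewrite kG // invr1 subrr (Gn 0%N) ?lexx ?ler01 // mulr0 subr0.
  by have [_ -> _] := pg 0%N.
have kA0 : k @` `[0, 1] `<=` A 0%N.
  move=> _ [t /= + <-]; rewrite in_itv /= => /andP[].
  rewrite le_eqVlt => /orP[/eqP <- _|t0 tle1]; first by rewrite k0.
  by apply: kA; rewrite ?invr1.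
exists k; split => //.
apply/subspace_continuousP => t /=; rewrite in_itv /= => /andP[].
rewrite le_eqVlt => /orP[/eqP <- _|t0 tle1] U.
  rewrite /from_subspace k0 => /baseA [n AU].
  have : nbhs (0 : R) (fun s => s < n.+1%:R^-1).
    by apply: lt_nbhsl; rewrite invr_gt0.
  apply: (@filterS _ (nbhs (0 : R))) => s sn; rewrite /= in_itv /= => /andP[].
  rewrite le_eqVlt => /orP[/eqP <- _|s0 _]; apply: AU; last exact/kA/ltW.
  by rewrite k0.
(* With this [n], the time [t] lies beyond [1 / n.+1], where only [G] on [[0, n]] is involved. *)
move=> kU; pose n := Num.truncn t^-1.
have tn : n.+1%:R^-1 < t.
  rewrite -[ltRHS]invrK ltf_pV2 ?posrE ?invr_gt0 //.
  by have /andP[] := truncn_itv (ltW (etrans (invr_gt0 t) t0)).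
have ck : {within `[n.+1%:R^-1, 1], continuous k}.
  have ci : {within `[n.+1%:R^-1, 1], continuous (fun s : R => s^-1 - 1)}.
    apply: continuous_in_subspaceT => s; rewrite inE /= in_itv /= => /andP[ns _].
    apply: cvgB; last exact: cvg_cst.
    apply: cvgV; last exact: cvg_id.
    by rewrite gt_eqF // (lt_le_trans _ ns) // invr_gt0.
  have ns0 (s : R) : `[n.+1%:R^-1, 1]%classic s -> 0 < s.
    by rewrite /= in_itv /= => /andP[ns _]; rewrite (lt_le_trans _ ns) // invr_gt0.
  apply: (within_eq_continuous (g := G \o (fun s => s^-1 - 1))).
    by move=> s /ns0 s0; rewrite kG.
  apply: within_continuous_compS ci (cG n) _ => _ [s sn <-].
  have s0 := ns0 _ sn; move: sn; rewrite /= !in_itv /= => /andP[ns s1].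
  rewrite t1 //= lerBlDr natr1 -[leRHS]invrK lef_pV2 ?posrE ?invr_gt0 //.
have tI : `[n.+1%:R^-1, 1]%classic t by rewrite /= in_itv /= (ltW tn).
move/subspace_continuousP : ck => /(_ t tI U kU) ck.
have {}ck : nbhs t (fun s => `[n.+1%:R^-1, 1]%classic s -> U (k s)) by [].
have gt : nbhs t (fun s => n.+1%:R^-1 < s) by exact: lt_nbhsr.
change (nbhs t (fun s => `[0, 1]%classic s -> U (k s))).
apply: filterS2 ck gt => s h ns; rewrite /= in_itv /= => /andP[_ s1].
by apply: h; rewrite /= in_itv /= (ltW ns).
Qed.

End paths.

(** * Trivializing sets *)

(** Openness of [p] over [W] makes the pointwise inverse on a component continuous. *)
Lemma evenly_covered_intro (X Y : topologicalType) (p : X -> Y) (W : set Y) :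
  continuous p -> locally_connected X -> open W ->
  (forall x Q, W (p x) -> nbhs x Q -> nbhs (p x) (p @` Q)) ->
  (forall x, W (p x) -> W `<=` p @` connected_component (p @^-1` W) x) ->
  (forall x x1 x2, connected_component (p @^-1` W) x x1 ->
    connected_component (p @^-1` W) x x2 -> p x1 = p x2 -> x1 = x2) ->
  evenly_covered p W.
Proof.
move=> cp lX oW op surj inj _ [x Wx <-]; set C := connected_component _ x.
have oC : open C.
  by apply: component_open => //; move/continuousP: cp; exact.
pose g y := xget x [set z | C z /\ p z = y].
have gP y : W y -> C (g y) /\ p (g y) = y.
  move=> /(surj _ Wx) [z Cz pz]; rewrite /g; case: xgetP => [//|/(_ z)].
  by case.
have gp z : C z -> g (p z) = z.
  move=> Cz; have [Cg pg] := gP (p z) (connected_component_sub Cz).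
  exact: inj Cg Cz pg.
split; first exact: continuous_subspaceT.
split.
  apply/seteqP; split => [_ [z Cz <-]|]; last exact: surj.
  exact: connected_component_sub Cz.
exists g; split => //; last first.
  apply/seteqP; split => [_ [y /gP[? _] <-]//|z Cz].
  by exists (p z); [exact: connected_component_sub Cz|exact: gp].
apply/subspace_continuousP => y Wy U gU.
have [Cy py] := gP y Wy.
have : nbhs (p (g y)) (p @` (U `&` C)).
  apply: op; first by rewrite py.
  by apply: filterI => //; exact: open_nbhs_nbhs.
rewrite py; change (nbhs y (p @` (U `&` C)) -> nbhs y (fun y' => W y' -> U (g y'))).
by apply: (@filterS _ (nbhs y)) => _ [z [Uz Cz] <-] _; rewrite gp.
Qed.

Section trivializing.
Context (R : realType) (Y : topologicalType) (S : set Y).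
Hypothesis skelS : skeletal S.

Lemma ordinary_openmap (X : topologicalType) (p : X -> Y) (x : X) (Q : set X) :
  spread p -> locally_connected Y -> ordinary p (p x) -> nbhs x Q ->
  nbhs (p x) (p @` Q).
Proof.
move=> sp lY px xQ; have [U [oU cU Ux] UQ] := spread_nbhs lY sp xQ.
have [|W [[oW cW Wx] WU ev]] := ordinary_nbhs (O := U) lY px.
  exact: open_nbhs_nbhs.
apply: (@filterS _ _ _ W); last exact: open_nbhs_nbhs.
move=> y /(evenly_covered_surj ev Wx) [z xz <-]; exists z => //; apply: UQ.
by apply: sub_connected_component xz; exact: preimage_subset.
Qed.

Definition trivializing (W : set Y) :=
  [/\ open W, connected W, W `<=` ~` S &
    forall (X : topologicalType) (p : X -> Y),
      covering_branched_over R S p -> evenly_covered p W].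

Lemma null_homotopic_covering (X : topologicalType) (p : X -> Y)
    (z : set_type (~` S)) (U : set (set_type (~` S))) (W : set Y)
    (a b : X) (g : R -> X) :
  covering_branched_over R S p ->
  (forall l : R -> set_type (~` S), path_in U z z l -> null_homotopic z l) ->
  W `<=` ~` S -> (forall w : set_type (~` S), W (val w) -> U w) ->
  path_in (p @^-1` W) a b g -> p a = val z -> p b = val z -> a = b.
Proof.
move=> cov nullU WS WU [cg g0 g1 gW] pa pb.
have [lX lY] := covering_lc cov.
have [[_ _ [[cp _] _] _ _] _] := cov.
(* Outside [[0, 1]] nothing is known about [g]; the default [z] fills in there. *)
pose l t : set_type (~` S) := insubd z (p (g t)).
have gWt t : `[0, 1]%classic t -> W (p (g t)) by move=> ?; apply: gW; exists t.
have lE t : `[0, 1]%classic t -> val (l t) = p (g t).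
  by move=> /gWt/WS h; rewrite val_insubd mem_set.
have I0 : `[0, 1]%classic (0 : R) by rewrite /= in_itv /= lexx ler01.
have I1 : `[0, 1]%classic (1 : R) by rewrite /= in_itv /= lexx ler01.
have pl : path_in U z z l.
  split.
  - apply/subspace_continuousP => t It V.
    rewrite /from_subspace => -[V0 [[V1 oV1 <-] V1t] V1V].
    have : nbhs (p (g t)) V1.
      by apply: open_nbhs_nbhs; split => //; rewrite -lE.
    move=> /cp => pV1; move/subspace_continuousP: cg => /(_ t It _ pV1).
    change (nbhs t (fun s => `[0, 1]%classic s -> V1 (p (g s))) ->
      nbhs t (fun s => `[0, 1]%classic s -> V (l s))).
    apply: filterS => s h Is; apply: V1V; rewrite /preimage /=.
    by have := h Is; rewrite -lE.
  - by apply: val_inj; rewrite lE // g0.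
  - by apply: val_inj; rewrite lE // g1.
  - by move=> _ [t It <-]; apply: WU; rewrite lE //; exact: gWt.
have [H [cH H0 H1 H01]] := nullU l pl.
rewrite -g0 -g1.
apply: (null_homotopic_lift (p := p) (H := val \o H)) => //.
- apply: (within_continuous_compS (B := setT) cH) => //.
  exact/continuous_subspaceT/initial_continuous.
- move=> c _; apply: (covering_ordinary cov).
  exact: set_mem (valP (H c)).
- by move=> t It; rewrite /= H0 ?lE // inE.
- by move=> t It; rewrite /= H1 ?g0 // inE.
- by move=> s Is; rewrite /= g0; have [|-> ->] := H01 s; rewrite ?inE.
Qed.

Lemma trivializing_nbhs (y : Y) (O : set Y) :
  admissible_space R Y ->
  semilocally_simply_connected R (set_type (~` S)) ->
  ~ S y -> nbhs y O -> exists W, [/\ trivializing W, W y & W `<=` O].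
Proof.
move=> [hY lpY _] slsc Sy yO.
have lY := locally_path_connectedW lpY.
have [oS _ cS] := skelS.
pose z : set_type (~` S) := exist _ y (mem_set Sy).
have [U [U0 [[V oV VU0] /= U0z] U0U] nullU] := slsc z.
have Vy : V y by move: U0z; rewrite -VU0.
have [|W [oW Wy pW WO]] := lpY y ((O `&` V) `&` ~` S).
  apply: filterI; first by apply: filterI => //; exact: open_nbhs_nbhs.
  exact: open_nbhs_nbhs.
have WS : W `<=` ~` S by move=> w /WO [].
exists W; split => //; last by move=> w /WO [[]].
have cW := path_connected_connected pW.
split => // X p cov.
have [lX _] := covering_lc cov.
have [[[[_ lpX _] _] _ [[cp gp] _] _ _] _] := cov.
have oC x : open (connected_component (p @^-1` W) x).
  by apply: component_open => //; move/continuousP: cp; exact.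
have surj x : W (p x) -> W `<=` p @` connected_component (p @^-1` W) x.
  move=> Wx w Ww; have WE : W `&` ~` S = W by apply/setIidPl.
  apply: (component_image (D := ~` S) lY (covering_ordinary cov)) => //.
  - by rewrite WE.
  - exact: WS.
  - by rewrite WE.
apply: evenly_covered_intro => //.
  move=> x Q Wx; apply: ordinary_openmap => //.
  by apply: (covering_ordinary cov); exact: WS.
move=> x x1 x2 Cx1 Cx2 e; have Wx1 := connected_component_sub Cx1.
pose P w := forall a b, connected_component (p @^-1` W) x a ->
  connected_component (p @^-1` W) x b -> p a = w -> p b = w -> a = b.
(* The contraction gives injectivity over [y] only; it propagates over [W]
   because having a single preimage in the component is locally constant. *)
suff : W `<=` P by move=> /(_ _ Wx1); apply.
apply: (locally_constant_connected cW Wy) => [a b Ca Cb pa pb|w Ww].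
  have [g [cg g0 g1 gC]] := open_connected_path_connected lpX (oC x)
    (@component_connected _ _ _) Ca Cb.
  apply: (null_homotopic_covering (z := z) (U := U) (W := W) (g := g) cov) => //.
    by move=> u Wu; apply: U0U; rewrite -VU0; have [[]] := WO _ Wu.
  split => // _ [t It <-]; apply: (connected_component_sub (x := x)).
  by apply: gC; exists t.
have [|W1 [[oW1 cW1 W1w] W1W ev]] :=
    ordinary_nbhs (O := W) lY (covering_ordinary cov (WS _ Ww)).
  exact: open_nbhs_nbhs.
apply: (@filterS _ _ _ W1); last exact: open_nbhs_nbhs.
have key w1 w2 : W1 w1 -> W1 w2 -> P w1 -> P w2.
  move=> Ww1 Ww2 P1 a b Ca Cb pa pb.
  have sub v u : connected_component (p @^-1` W1) v u ->
      connected_component (p @^-1` W) x v -> connected_component (p @^-1` W) x u.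
    move=> vu xv; apply: (connected_component_trans xv).
    by apply: sub_connected_component vu; exact: preimage_subset.
  have [|a1 aa1 pa1] := evenly_covered_surj (p := p) (x := a) ev _ Ww1.
    by rewrite pa.
  have [|b1 bb1 pb1] := evenly_covered_surj (p := p) (x := b) ev _ Ww1.
    by rewrite pb.
  have ab : a1 = b1 by apply: P1 pa1 pb1; [exact: sub aa1 Ca|exact: sub bb1 Cb].
  rewrite -ab in bb1.
  apply: (evenly_covered_inj ev (x := a1)); last by rewrite pa pb.
    exact: connected_component_sym.
  exact: connected_component_sym.
by move=> w' Ww' _; split; exact: key.
Qed.

End trivializing.

(** * Chains of trivializing sets *)

Section chains.
Context (R : realType) (Y : topologicalType) (S : set Y) (y0 : Y).

(* A chain starts at [y0] and moves, for each entry [(W, w)], inside [W] to the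
   point [w]; the last move comes first in the list. *)
Definition chain := seq (set Y * Y).
Implicit Types (c : chain) (W U V : set Y) (w y : Y).

Definition chain_end c : Y := if c is (_, w) :: _ then w else y0.

Fixpoint chain_valid c : Prop :=
  if c is (W, w) :: c' then
    [/\ trivializing R S W, W (chain_end c'), W w & chain_valid c']
  else True.

(** The default [x] is returned only if no such point exists; over a trivializing [W] containing
    [p x] and [w], the point exists and is unique. *)
Definition transport1 (X : topologicalType) (p : X -> Y) (x : X) W w : X :=
  xget x [set x' | connected_component (p @^-1` W) x x' /\ p x' = w].

Fixpoint transport (X : topologicalType) (p : X -> Y) (x : X) c : X :=
  if c is (W, w) :: c' then transport1 p (transport p x c') W w else x.

(* The universal covering of [~` S] is the quotient of the chains by this
   relation: acting alike on all pointed coverings replaces homotopy. *)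
Definition chain_equiv c c' :=
  [/\ chain_valid c, chain_valid c', chain_end c = chain_end c' &
    forall (X : topologicalType) (p : X -> Y) (x : X),
      covering_branched_over R S p -> p x = y0 ->
      transport p x c = transport p x c'].

(* The classes of [joined U] are the components of the part of the universal
   covering of [~` S] which lies over [U]. *)
Inductive joined U c : chain -> Prop :=
| joined_refl : joined U c c
| joined_equiv c1 c2 : joined U c c1 -> chain_equiv c1 c2 -> joined U c c2
| joined_step c1 W w : joined U c c1 -> trivializing R S W -> W `<=` U ->
    W (chain_end c1) -> W w -> joined U c ((W, w) :: c1).

Section transport.
Context (X : topologicalType) (p : X -> Y).
Hypothesis cov : covering_branched_over R S p.

Lemma transport1P (x : X) W w : trivializing R S W -> W (p x) -> W w ->
  connected_component (p @^-1` W) x (transport1 p x W w) /\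
  p (transport1 p x W w) = w.
Proof.
move=> [_ _ _ /(_ _ _ cov) ev] Wx Ww; rewrite /transport1.
case: xgetP => [//|h].
by have [x' xx' px'] := evenly_covered_surj ev Wx Ww; case: (h x').
Qed.

Lemma transport_end (x : X) c : p x = y0 -> chain_valid c ->
  p (transport p x c) = chain_end c.
Proof.
move=> px; elim: c => [//|[W w] c IH] /= [tW We Ww vc].
by apply: (transport1P tW _ Ww).2; rewrite IH.
Qed.

End transport.

Lemma chain_equiv_sym c c' : chain_equiv c c' -> chain_equiv c' c.
Proof. by move=> [v v' e H]; split => // X p x cov px; rewrite H. Qed.

Lemma joined_valid U c c' : chain_valid c -> joined U c c' -> chain_valid c'.
Proof. by move=> vc; elim=> [//|c1 c2 _ _ []//|c1 W w _ v1 *]; split. Qed.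

Lemma joined_end U c c' : U (chain_end c) -> joined U c c' -> U (chain_end c').
Proof.
move=> vc; elim=> [//|c1 c2 _ + [_ _ <-]//|c1 W w _ _ _ WU _ Ww].
exact: WU.
Qed.

Lemma joined_trans U c1 c2 c3 : joined U c1 c2 -> joined U c2 c3 ->
  joined U c1 c3.
Proof.
move=> c12; elim=> [//|c c' _ h e|c W w _ h *]; first exact: joined_equiv h e.
exact: joined_step.
Qed.

Lemma sub_joined U V c c' : U `<=` V -> joined U c c' -> joined V c c'.
Proof.
move=> UV; elim=> [|c1 c2 _ h e|c1 W w _ h tW WU We Ww].
- exact: joined_refl.
- exact: joined_equiv h e.
- by apply: joined_step => //; exact: subset_trans UV.
Qed.

Lemma joined_transport U c c' (X : topologicalType) (p : X -> Y) (x : X) :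
  covering_branched_over R S p -> p x = y0 -> chain_valid c ->
  U (chain_end c) -> joined U c c' ->
  connected_component (p @^-1` U) (transport p x c) (transport p x c').
Proof.
move=> cov px vc Uc; elim=> [|c1 c2 _ h [_ _ _ <-//]|c1 W w j1 h tW WU We Ww].
  by apply: connected_component_refl; rewrite /preimage /= transport_end.
apply: (connected_component_trans h).
have v1 := joined_valid vc j1.
have [|+ _] := transport1P (p := p) cov (x := transport p x c1) tW _ Ww.
  by rewrite transport_end.
by apply: sub_connected_component; exact: preimage_subset.
Qed.

(** In every covering, the transports along both chains lie in one component over [W] and above the
    same point, hence coincide. The later equivalences of chains are obtained this way. *)
Lemma joined_chain_equiv W c c' :
  trivializing R S W -> chain_valid c -> W (chain_end c) ->
  joined W c c' -> chain_end c = chain_end c' -> chain_equiv c c'.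
Proof.
move=> tW vc Wc j e; have vc' := joined_valid vc j.
split => // X p x cov px; have [_ _ _ /(_ _ _ cov) ev] := tW.
apply: (evenly_covered_inj ev) (joined_transport cov px vc Wc j) _.
  by apply: connected_component_refl; rewrite /preimage /= transport_end.
by rewrite !transport_end.
Qed.

Lemma chain_stay W c : trivializing R S W -> chain_valid c -> W (chain_end c) ->
  chain_equiv c ((W, chain_end c) :: c).
Proof.
move=> tW vc Wc; apply: (joined_chain_equiv tW) => //.
by apply: joined_step => //; exact: joined_refl.
Qed.

(** A step inside [W] is undone by returning to [chain_end c1] inside [W]; the detour is equivalent
    to [c1]. *)
Lemma joined_sym U c c' : chain_valid c -> joined U c c' -> joined U c' c.
Proof.
move=> vc; elim=> [|c1 c2 _ h e|c1 W w j1 h tW WU We Ww].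
- exact: joined_refl.
- apply: joined_trans h; apply: (joined_equiv _ (chain_equiv_sym e)).
  exact: joined_refl.
- apply: joined_trans h; have v1 := joined_valid vc j1.
  apply: (@joined_equiv _ _ ((W, chain_end c1) :: (W, w) :: c1)).
    by apply: joined_step => //; exact: joined_refl.
  apply/chain_equiv_sym/(joined_chain_equiv tW) => //.
  by do 2 (apply: joined_step => //); exact: joined_refl.
Qed.

Lemma joined_eq U c c' : chain_valid c -> joined U c c' ->
  joined U c = joined U c'.
Proof.
move=> vc j; apply/funext => d; apply/propext; split; apply: joined_trans => //.
exact: joined_sym.
Qed.

Lemma chain_end_ordinary c : ~ S y0 -> chain_valid c -> ~ S (chain_end c).
Proof. by move=> Sy; case: c => [//|[W w] c] /= [[_ _ + _] _ Ww _]; apply. Qed.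

End chains.

(** * The completion *)

Lemma path_reverse (R : realType) (X : topologicalType) (A : set X) (x y : X)
    (g : R -> X) :
  path_in A x y g -> exists k : R -> X, path_in A y x k.
Proof.
move=> [cg g0 g1 gA]; exists (fun t => g (-1 * t + 1)).
have I01 t : `[0, 1]%classic t -> `[0, 1]%classic (-1 * t + 1 : R).
  by rewrite /= !in_itv /= => /andP[? ?]; apply/andP; split; lra.
split.
- exact: within_affine_continuous cg I01.
- by rewrite mulr0 add0r.
- by rewrite mulr1 addNr.
- by move=> _ [t /I01 It <-]; apply: gA; exists (-1 * t + 1).
Qed.

Section completion.
Context (R : realType) (Y : topologicalType) (S : set Y) (y0 : Y).
Implicit Types (c : chain Y) (W U V : set Y) (w y : Y).

Local Notation valid := (chain_valid R S y0).
Local Notation cend := (chain_end y0).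
Local Notation triv := (trivializing R S).
Local Notation joined := (joined R S y0).

(* Off the connected open neighbourhoods of [y], [chi] is normalized to [set0],
   so that points of the completion are equal when they agree on them. *)
Definition is_branch y (chi : set Y -> set (chain Y)) :=
  [/\ forall U, conn_open_nbhs y U ->
        exists c, [/\ valid c, U (cend c) & chi U = joined U c],
      forall U, ~ conn_open_nbhs y U -> chi U = set0 &
      forall U V, conn_open_nbhs y U -> conn_open_nbhs y V ->
        U `<=` V -> chi U `<=` chi V].

Record completion := Completion {
  base_point : Y;
  branch : set Y -> set (chain Y);
  branchP : is_branch base_point branch
}.

HB.instance Definition _ := gen_eqMixin completion.
HB.instance Definition _ := gen_choiceMixin completion.

Implicit Types z : completion.

Definition sheet U (C : set (chain Y)) : set completion :=
  [set z | conn_open_nbhs (base_point z) U /\ branch z U = C].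

(* Finite families of neighbourhoods make this a topology without assuming that
   [Y] is locally connected; when it is, single neighbourhoods suffice, see
   [sheet_nbhs]. *)
Definition completion_open (Q : set completion) := forall z, Q z ->
  exists s : seq (set Y),
    (forall U, U \in s -> conn_open_nbhs (base_point z) U) /\
    (forall z', (forall U, U \in s -> sheet U (branch z U) z') -> Q z').

Let openT : completion_open setT.
Proof. by move=> z _; exists [::]. Qed.

Let openI : setI_closed completion_open.
Proof.
move=> A B oA oB z [/oA [s [s1 s2]] /oB [t [t1 t2]]]; exists (s ++ t); split.
  by move=> U; rewrite mem_cat => /orP[/s1|/t1].
move=> z' st; split; [apply: s2|apply: t2] => U Us; apply: st;
  by rewrite mem_cat Us ?orbT.
Qed.

Let open_bigU (I : Type) (f : I -> set completion) :
  (forall i, completion_open (f i)) -> completion_open (\bigcup_i f i).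
Proof.
move=> of_ z [i _ /of_ [s [s1 s2]]]; exists s; split => // z' /s2 fz'.
by exists i.
Qed.

HB.instance Definition _ :=
  @isOpenTopological.Build completion completion_open openT openI open_bigU.

Lemma branch_joined z U c : branch z U c ->
  [/\ conn_open_nbhs (base_point z) U, valid c, U (cend c) &
    branch z U = joined U c].
Proof.
have [b1 b2 _] := branchP z.
have [zU|/b2 ->//] := pselect (conn_open_nbhs (base_point z) U).
have [d [vd Ud ->]] := b1 U zU; move=> dc; split => //.
- exact: joined_valid dc.
- exact: joined_end dc.
- exact: joined_eq.
Qed.

Lemma branch_nonempty z U : conn_open_nbhs (base_point z) U ->
  exists c, branch z U c.
Proof.
have [b1 _ _] := branchP z; move=> /b1 [c [_ _ ->]]; exists c.
exact: joined_refl.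
Qed.

Lemma branch_sub z U V : conn_open_nbhs (base_point z) U ->
  conn_open_nbhs (base_point z) V -> U `<=` V -> branch z U `<=` branch z V.
Proof. by have [_ _] := branchP z; exact. Qed.

Lemma branch_eq z z' U c : branch z U c -> branch z' U c ->
  branch z U = branch z' U.
Proof. by move=> /branch_joined[_ _ _ ->] /branch_joined[_ _ _ ->]. Qed.

Lemma sheet_sub z U V : conn_open_nbhs (base_point z) U ->
  open V -> connected V -> U `<=` V ->
  sheet U (branch z U) `<=` sheet V (branch z V).
Proof.
move=> zU oV cV UV z' [z'U e].
have zV : conn_open_nbhs (base_point z) V by split => //; apply: UV; case: zU.
have z'V : conn_open_nbhs (base_point z') V by split => //; apply: UV; case: z'U.
have [c zc] := branch_nonempty zU; split => //.
apply: (@branch_eq _ _ _ c); first by apply: (branch_sub z'U z'V UV); rewrite e.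
exact: (branch_sub zU zV UV).
Qed.

Lemma sheet_open U C : open (sheet U C).
Proof.
move=> z [zU zC]; exists [:: U]; split => [V|z' h].
  by rewrite inE => /eqP ->.
by rewrite -zC; apply: h; rewrite inE.
Qed.

Lemma completion_eq z z' : base_point z = base_point z' ->
  (forall U, conn_open_nbhs (base_point z) U -> branch z U = branch z' U) ->
  z = z'.
Proof.
have [_ b2 _] := branchP z; have [_ b2' _] := branchP z'.
move: b2 b2'; case: z => y chi h; case: z' => y' chi' h' /= b2 b2' e.
move: e h' b2' => <- h' b2' H.
have e : chi = chi'.
  apply/funext => U; have [yU|nU] := pselect (conn_open_nbhs y U); first exact: H.
  by rewrite b2 // b2'.
by move: e h' {b2' H} => <- h'; congr Completion; exact: Prop_irrelevance.
Qed.

Lemma chain_branch c : valid c -> is_branch (cend c)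
  (fun U => [set c' | conn_open_nbhs (cend c) U /\ joined U c c']).
Proof.
move=> vc; split.
- move=> U cU; exists c; split => //; first by case: cU.
  by apply/seteqP; split => [c' []|c'].
- by move=> U nU; apply/seteqP; split => [c' []|].
- by move=> U V cU cV UV c' [_ h]; split => //; exact: sub_joined h.
Qed.

(* Invalid chains are sent to the base point. *)
Definition chain_point c : completion :=
  if pselect (valid c) is left vc then Completion (chain_branch vc)
  else Completion (@chain_branch [::] I).

Lemma base_chain_point c : valid c -> base_point (chain_point c) = cend c.
Proof. by rewrite /chain_point; case: pselect. Qed.

Lemma branch_chain_point c U : valid c -> conn_open_nbhs (cend c) U ->
  branch (chain_point c) U = joined U c.
Proof.
rewrite /chain_point; case: pselect => //= vc _ cU.
by apply/seteqP; split => [c' []|c'].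
Qed.

Lemma chain_point_equiv c c' : chain_equiv R S y0 c c' ->
  chain_point c = chain_point c'.
Proof.
move=> [vc vc' e H]; apply: completion_eq; rewrite !base_chain_point // => U cU.
rewrite !branch_chain_point // -?e //; apply: joined_eq => //.
by apply: joined_equiv (joined_refl _ _ _ _ _) _; split.
Qed.

Lemma sheet_chain_point U c c' : open U -> connected U ->
  valid c' -> U (cend c') -> joined U c' c -> sheet U (joined U c) (chain_point c').
Proof.
move=> oU cU vc' Uc' j; split; first by rewrite base_chain_point.
by rewrite branch_chain_point //; exact: joined_eq.
Qed.

End completion.

(** * The completion is the universal branched covering *)

Section completion_covering.
Context (R : realType) (Y : topologicalType) (S : set Y) (y0 : Y).
Hypotheses (aY : admissible_space R Y) (cY : connected [set: Y]).
Hypotheses (skelS : skeletal S).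
Hypothesis slscYS : semilocally_simply_connected R (set_type (~` S)).
Hypothesis Sy0 : ~ S y0.

Local Notation valid := (chain_valid R S y0).
Local Notation cend := (chain_end y0).
Local Notation triv := (trivializing R S).
Local Notation joined := (joined R S y0).
Local Notation T := (completion R S y0).
Local Notation point c := (chain_point R S y0 c).
Local Notation pr := (@base_point R Y S y0).
Local Notation sheet := (@sheet R Y S y0).

Implicit Types (c : chain Y) (U V W : set Y) (z : T).

Let lY : locally_connected Y.
Proof. by have [_ lpY _] := aY; exact: locally_path_connectedW lpY. Qed.

Let triv_nbhs y U : ~ S y -> nbhs y U -> exists W, [/\ triv W, W y & W `<=` U].
Proof. exact: trivializing_nbhs. Qed.

Lemma sheet_nbhs z (Q : set T) : nbhs z Q ->
  exists2 U, conn_open_nbhs (pr z) U & sheet U (branch z U) `<=` Q.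
Proof.
rewrite nbhsE => -[Q' [oQ' Q'z] Q'Q].
have [s [s1 s2]] : exists s : seq (set Y),
    (forall U, U \in s -> conn_open_nbhs (pr z) U) /\
    (forall z', (forall U, U \in s -> sheet U (branch z U) z') -> Q' z').
  exact: (oQ' z Q'z).
have : nbhs (pr z) (fun y => forall U, U \in s -> U y).
  elim: s s1 {s2} => [_|U s IH s1]; first by apply: filterE.
  have [|oU _ Uz] := s1 U; first by rewrite inE eqxx.
  have zU : nbhs (pr z) U by exact: open_nbhs_nbhs.
  apply: filterS2 zU (IH _) => [y Uy h V|V Vs].
    by rewrite inE => /orP[/eqP ->|/h].
  by apply: s1; rewrite inE Vs orbT.
move=> /lY [V [oV cV Vz Vs]]; exists V => //; apply: subset_trans Q'Q => z' zz'.
apply: s2 => U Us; have [oU cU _] := s1 U Us.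
by apply: (sheet_sub _ _ _ _ zz') => // y /Vs; exact.
Qed.

Lemma base_point_continuous : continuous pr.
Proof.
move=> z Q /lY [U [oU cU Uz UQ]].
apply: (@filterS _ (nbhs z) _ (sheet U (branch z U))).
  by move=> z' [[_ _ Uz'] _]; exact: UQ.
by apply: open_nbhs_nbhs; split; [exact: sheet_open|split].
Qed.

Lemma base_point_preimage U : open U -> connected U ->
  pr @^-1` U = \bigcup_(C in [set C | sheet U C !=set0]) sheet U C.
Proof.
move=> oU cU; apply/seteqP; split => [z Uz|z [C _ [[] _ _ Uz] _]//].
have zU : sheet U (branch z U) z by split.
by exists (branch z U) => //; exists z.
Qed.

(** Extend a chain representing [z] over a trivializing [W] by a step to [pr z]. For any other [U],
    extend likewise a chain representing [z] over a trivializing subset of both [W] and [U]: the two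
    are joined inside [W], hence equivalent. *)
Lemma ordinary_point z : ~ S (pr z) ->
  exists2 c, valid c & z = point c.
Proof.
move=> Sz; have [W [tW Wz _]] := triv_nbhs Sz filterT.
have [oW cW _ _] := tW.
have [c0 /branch_joined [zW v0 W0 bW]] : exists c, branch z W c.
  exact: branch_nonempty.
pose c := (W, pr z) :: c0.
have vc : valid c by split.
have j0c : joined W c0 c by apply: joined_step => //; exact: joined_refl.
exists c => //; apply: completion_eq => [|U zU]; first by rewrite base_chain_point.
rewrite branch_chain_point //.
have [oU cU Uz] := zU.
have [|W' [tW' W'z W'WU]] := triv_nbhs (U := W `&` U) Sz.
  by apply: filterI; exact: open_nbhs_nbhs.
have [oW' cW' _ _] := tW'.
have [c1 zc1] : exists c, branch z W' c by exact: branch_nonempty.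
have [zW' v1 W'1 bW'] := branch_joined zc1.
have zUc1 : branch z U c1 by apply: (branch_sub zW' zU _ zc1) => y /W'WU [].
have zWc1 : branch z W c1 by apply: (branch_sub zW' zW _ zc1) => y /W'WU [].
pose c2 := (W', pr z) :: c1.
have [_ _ U1 ->] := branch_joined zUc1.
apply: joined_eq => //; apply: (@joined_equiv _ _ _ _ _ _ c2).
  by apply: joined_step => //; [exact: joined_refl|move=> y /W'WU []].
apply/chain_equiv_sym/(joined_chain_equiv tW) => //.
apply: (joined_trans (c2 := c0)); first exact: joined_sym.
apply: (joined_trans (c2 := c1)); first by rewrite -bW.
by apply: joined_step => //; [exact: joined_refl|move=> y /W'WU []].
Qed.

(** Moving from [w] to a nearby [w'] inside a smaller trivializing set is equivalent to moving to
    [w'] directly inside [W]. *)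
Lemma section_continuous W c : triv W -> valid c -> W (cend c) ->
  {within W, continuous (fun w => point ((W, w) :: c))}.
Proof.
move=> tW vc Wc; apply/subspace_continuousP => w Ww Q.
have vw : valid ((W, w) :: c) by split.
move=> /sheet_nbhs [U]; rewrite base_chain_point //= => wU UQ.
have [oU cU Uw] := wU; have [oW _ WS _] := tW.
have [|W' [tW' W'w W'WU]] := triv_nbhs (U := W `&` U) (WS _ Ww).
  by apply: filterI; exact: open_nbhs_nbhs.
have [oW' _ _ _] := tW'.
have : nbhs w W' by exact: open_nbhs_nbhs.
change (nbhs w W' -> nbhs w (fun w' => W w' -> Q (point ((W, w') :: c)))).
apply: filterS => w' W'w' Ww'; apply: UQ; rewrite branch_chain_point //.
apply: sheet_chain_point => //=; first by have [] := W'WU _ W'w'.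
apply: joined_sym => //.
have st d v : joined W c d -> W (cend d) -> W v -> joined W c ((W, v) :: d).
  by move=> jd Wd Wv; apply: joined_step.
have jr : joined W c c by exact: joined_refl.
apply: (@joined_equiv _ _ _ _ _ _ ((W', w') :: (W, w) :: c)).
  by apply: joined_step => //; [exact: joined_refl|move=> y /W'WU []].
apply: (joined_chain_equiv tW) => //=.
  apply: (joined_trans (c2 := c)); last exact: st.
  apply: joined_sym => //; apply: joined_step => //; first exact: st.
  by move=> y /W'WU [].
Qed.

(** Each step of [joined] contributes the image of a path in [W] under the local section;
    equivalences do not move the point. Keeping the path off [S] later gives portliness of the
    preimage of the complement of [S]. *)
Lemma sheet_chain_path U c c' : open U -> connected U -> valid c -> U (cend c) ->
  joined U c c' -> exists g : R -> T,
    path_in (sheet U (joined U c) `&` pr @^-1` (~` S)) (point c) (point c') g.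
Proof.
move=> oU cU vc Uc; have [_ lpY _] := aY.
have inC d : joined U c d ->
    (sheet U (joined U c) `&` pr @^-1` (~` S)) (point d).
  move=> j; have vd := joined_valid vc j; split.
    apply: sheet_chain_point => //; first exact: joined_end j.
    exact: joined_sym.
  by rewrite /preimage /= base_chain_point //; exact: chain_end_ordinary vd.
elim => [|c1 c2 _ [g pg] e|c1 W w j1 [g pg] tW WU We Ww].
- by exists (fun=> point c); apply: path_cst; apply: inC; exact: joined_refl.
- by exists g; rewrite -(chain_point_equiv e).
have v1 := joined_valid vc j1; have [oW cW _ _] := tW.
have [h [ch h0 h1 hW]] := open_connected_path_connected lpY oW cW We Ww.
apply: (path_concat pg (h := fun t => point ((W, h t) :: c1))); split.
- apply: (within_continuous_compS ch (section_continuous tW v1 We)).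
  exact: hW.
- by rewrite h0; apply/esym/chain_point_equiv/chain_stay.
- by rewrite h1.
- move=> _ [t It <-]; apply: inC; apply: joined_step => //.
  by apply: hW; exists t.
Qed.

(** A point over [S] is not the point of a chain and has to be approached: chains [d n] representing
    it over shrinking [V n] are successively joined inside the sheets over the [V n], and these
    paths concatenate to one that converges to [z]. *)
Lemma sheet_path_to_chain U z : conn_open_nbhs (pr z) U ->
  exists c, branch z U c /\
    exists g : R -> T, path_in (sheet U (branch z U)) z (point c) g.
Proof.
move=> zU; have [oU cU Uz] := zU; have [_ _ fY] := aY.
have [V [zV decV baseV]] := conn_nbhs_sequence (pr z) fY lY.
have [|n0 Vn0] := baseV U; first exact: open_nbhs_nbhs.
have decV' m n : (m <= n)%N -> V n `<=` V m.
  move=> /subnK <-; elim: (n - m)%N => //= k IH.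
  by apply: subset_trans IH; exact: decV.
(* The shift by [n0] keeps the whole concatenation in the sheet over [U]. *)
pose A n := sheet (V (n0 + n)%N) (branch z (V (n0 + n)%N)).
have [d dP] := choice (fun n => branch_nonempty (zV (n0 + n)%N)).
have sub n W : open W -> connected W -> V n `<=` W ->
    sheet (V n) (branch z (V n)) `<=` sheet W (branch z W).
  by move=> oW cW; exact: sheet_sub.
have pA n : exists g : R -> T, path_in (A n) (point (d n)) (point (d n.+1)) g.
  have [[oV cV Vz] vd Vd bd] := branch_joined (dP n).
  have : joined (V (n0 + n)%N) (d n) (d n.+1).
    rewrite -bd; apply: (branch_sub (zV (n0 + n.+1)%N)) => //.
    by rewrite addnS; exact: decV.
  move=> /(sheet_chain_path oV cV vd Vd) [g [cg g0 g1 gA]]; exists g.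
  by split => // x /gA []; rewrite -bd.
have [g pg] := choice pA.
exists (d 0%N); split.
  by apply: (branch_sub (zV (n0 + 0)%N) zU _ (dP 0%N)); rewrite addn0.
have [||||k [ck k0 k1 kA]] := @path_infinite_concat R T A z
  (fun n => point (d n)) g.
- move=> Q /sheet_nbhs [W [oW cW Wz] WQ].
  have [|n Vn] := baseV W; first exact: open_nbhs_nbhs.
  exists n; apply: subset_trans WQ; apply: sub => //.
  by apply: subset_trans Vn; apply: decV'; exact: leq_addl.
- move=> n; have [oV cV _] := zV (n0 + n)%N; apply: sub => //.
  by rewrite addnS; exact: decV.
- by move=> n; split.
- exact: pg.
exists k; split => // x /kA; apply: sub => //.
by rewrite addn0.
Qed.

Lemma sheet_path_connected U C : @path_connected R T (sheet U C).
Proof.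
move=> z z' zC z'C; have [zU e] := zC; have [z'U e'] := z'C.
have [c [zc [g]]] := sheet_path_to_chain zU; rewrite e => pg.
have [c' [zc' [g']]] := sheet_path_to_chain z'U; rewrite e' => pg'.
have [[oU cU _] vc Uc bc] := branch_joined zc.
have [|h [ch h0 h1 hA]] := @sheet_chain_path U c c' oU cU vc Uc.
  by rewrite -bc e -e'.
have [k pk] := path_reverse pg'.
have [|gh pgh] := path_concat pg (h := h) (z := point c').
  by split => // x /hA []; rewrite -bc e.
exact: path_concat pgh pk.
Qed.

Lemma completion_lpc : locally_path_connected R T.
Proof.
move=> z Q /sheet_nbhs [U zU UQ]; exists (sheet U (branch z U)); split => //.
- exact: sheet_open.
- exact: sheet_path_connected.
Qed.

(** The sheets over [U] are open, path connected and partition the preimage of [U]. *)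
Lemma completion_component U z : open U -> connected U -> U (pr z) ->
  connected_component (pr @^-1` U) z = sheet U (branch z U).
Proof.
move=> oU cU Uz.
apply: (open_connected_cover_components (base_point_preimage oU cU)).
- move=> C _; split; first exact: sheet_open.
  exact/path_connected_connected/sheet_path_connected.
- by move=> C C' x _ _ [_ <-] [_ <-].
- by exists z.
- by [].
Qed.

Lemma completion_admissible : admissible_space R T.
Proof.
have [hY _ fY] := aY; split; last first.
- move=> z; have [V [zV _ baseV]] := conn_nbhs_sequence (pr z) fY lY.
  exists (range (fun n => sheet (V n) (branch z (V n)))); split.
  + exact: card_image_le.
  + move=> _ [n _ <-]; apply: open_nbhs_nbhs; split; first exact: sheet_open.
    by split.
  + move=> Q /sheet_nbhs [U [oU cU Uz] UQ].
    have [|n Vn] := baseV U; first exact: open_nbhs_nbhs.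
    exists (sheet (V n) (branch z (V n))); first by exists n.
    by apply: subset_trans UQ; exact: sheet_sub.
- exact: completion_lpc.
move=> z z' zz'; have e : pr z = pr z'.
  apply: hY => A B /base_point_continuous zA /base_point_continuous zB.
  by have [x [Ax Bx]] := zz' _ _ zA zB; exists (pr x).
apply: completion_eq => // U zU.
have [||x [[_ <-] [_ <-]]] := zz' (sheet U (branch z U)) (sheet U (branch z' U)).
- by apply: open_nbhs_nbhs; split; [exact: sheet_open|].
- by apply: open_nbhs_nbhs; split; [exact: sheet_open|split => //; rewrite -e].
by [].
Qed.

Lemma completion_connected : connected [set: T].
Proof.
have j c : valid c -> joined setT [::] c.
  elim: c => [_|[W w] c IH [tW We Ww vc]]; first exact: joined_refl.
  by apply: joined_step => //; exact: IH.
suff -> : [set: T] = sheet setT (joined setT [::]).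
  exact/path_connected_connected/sheet_path_connected.
have cT y : conn_open_nbhs y [set: Y] by split => //; exact: openT.
apply/seteqP; split => // z _; split => //.
have [c zc] := branch_nonempty (cT (pr z)); have [_ vc _ ->] := branch_joined zc.
by apply/esym/joined_eq => //; exact: j.
Qed.

Lemma completion_spread : spread pr.
Proof.
have lT := locally_path_connectedW completion_lpc.
apply: spreadP => // [|z Q /sheet_nbhs [U [oU cU Uz] UQ]].
  exact: base_point_continuous.
by exists U; split => //; rewrite completion_component.
Qed.

Lemma completion_complete : complete pr.
Proof.
move=> y chi _ chiC chiM.
(* Each [chi U] is a sheet, so its class is recovered as the set of chains whose points it contains.
   These classes form a branch, which is itself the required point. *)
pose br U := [set c | conn_open_nbhs y U /\ [/\ valid c, U (cend c) &
  chi U (point c)]].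
have chiE U : conn_open_nbhs y U -> exists c, [/\ valid c, U (cend c),
    chi U = sheet U (joined U c) & br U = joined U c].
  move=> yU; have [oU cU _] := yU; have [z Uz e] := chiC U yU.
  have [c zc] := branch_nonempty (And3 oU cU Uz).
  have [zU vc Uc bc] := branch_joined zc.
  have {}e : chi U = sheet U (joined U c).
    by rewrite -e completion_component // bc.
  exists c; split => //; apply/seteqP; split => [c' [_ [v' U' ]]|c' j].
    rewrite e => -[_]; rewrite branch_chain_point // => <-.
    exact: joined_refl.
  have v' := joined_valid vc j; have U' := joined_end Uc j.
  split => //; split => //; rewrite e; apply: sheet_chain_point => //.
  exact: joined_sym.
have bP : is_branch R S y0 y br.
  split.
  - by move=> U /chiE [c [vc Uc _ e]]; exists c.
  - by move=> U nU; apply/seteqP; split => // c [].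
  - move=> U V yU yV UV c [_ [vc Uc chic]]; split => //; split => //.
      exact: UV.
    exact: (chiM U V).
exists (Completion bP) => U yU; have [c [vc Uc -> e]] := chiE U yU.
by split.
Qed.

Lemma completion_dense : dense (pr @^-1` (~` S)).
Proof.
move=> Q [z Qz] oQ.
have [|U zU UQ] := sheet_nbhs (z := z) (Q := Q); first exact: open_nbhs_nbhs.
have [c zc] := branch_nonempty zU; have [[oU cU _] vc Uc bc] := branch_joined zc.
exists (point c); split.
  by apply: UQ; rewrite bc; apply: sheet_chain_point => //; exact: joined_refl.
by rewrite /preimage /= base_chain_point //; exact: chain_end_ordinary vc.
Qed.

(** Injectivity is the crux: points over [W] come from chains, and two chains in one sheet with the
    same end are joined inside [W], hence equivalent. *)
Lemma completion_evenly_covered W : triv W -> evenly_covered pr W.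
Proof.
move=> tW; have [oW cW WS _] := tW.
apply: evenly_covered_intro => //.
- exact: base_point_continuous.
- exact: locally_path_connectedW completion_lpc.
- move=> z Q Wz /sheet_nbhs [U zU UQ]; have [oU cU Uz] := zU.
  have [c vc zE] := ordinary_point (WS _ Wz).
  have ez : pr z = cend c by rewrite zE base_chain_point.
  have [|W' [tW' W'z W'U]] := triv_nbhs (U := U) (WS _ Wz).
    exact: open_nbhs_nbhs.
  have [oW' _ _ _] := tW'.
  have : nbhs (pr z) W' by exact: open_nbhs_nbhs.
  apply: filterS => w W'w.
  have vw : valid ((W', w) :: c) by split; rewrite -?ez.
  exists (point ((W', w) :: c)); last by rewrite base_chain_point.
  apply: UQ; rewrite zE branch_chain_point -?ez //.
  apply: sheet_chain_point => //=; first exact: W'U.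
  apply: joined_sym => //; apply: joined_step; rewrite -?ez //.
  exact: joined_refl.
- move=> z Wz w Ww; rewrite completion_component //.
  have [c vc zE] := ordinary_point (WS _ Wz).
  have ez : pr z = cend c by rewrite zE base_chain_point.
  have vw : valid ((W, w) :: c) by split; rewrite -?ez.
  exists (point ((W, w) :: c)); last by rewrite base_chain_point.
  rewrite zE branch_chain_point -?ez //.
  apply: sheet_chain_point => //=.
  apply: joined_sym => //; apply: joined_step; rewrite -?ez //.
  exact: joined_refl.
move=> z z1 z2 C1 C2 e.
have Wz : W (pr z).
  exact: (connected_component_sub (connected_component_sym C1)).
move: C1 C2; rewrite completion_component // => -[[_ _ W1] b1] [[_ _ W2] b2].
have [c1 v1 E1] := ordinary_point (WS _ W1).
have [c2 v2 E2] := ordinary_point (WS _ W2).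
move: W1 W2 b1 b2 e; rewrite E1 E2 !base_chain_point // => W1 W2.
rewrite !branch_chain_point // => b1 b2 e.
apply/chain_point_equiv/(joined_chain_equiv tW) => //.
by rewrite b1 -b2; exact: joined_refl.
Qed.

Lemma completion_covering : covering_branched_over R S pr.
Proof.
have [hY lpY fY] := aY.
have [oS dS cS] := skelS.
have lT := locally_path_connectedW completion_lpc.
have ordS : ~` S `<=` ordinary pr.
  move=> y Sy; have [W [tW Wy _]] := triv_nbhs Sy filterT.
  exists W; have [oW _ _ _] := tW; split => //.
  exact: completion_evenly_covered.
have opr U : open U -> open (pr @^-1` U).
  by have /continuousP := base_point_continuous; exact.
have pT : portly (pr @^-1` (~` S)).
  split; [exact: opr|exact: completion_dense|move=> Q oQ cQ].
  apply: dense_locally_connected => //; first exact: completion_dense.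
  move=> z Qz; have [|U zU UQ] := sheet_nbhs (z := z) (Q := Q).
    exact: open_nbhs_nbhs.
  exists (sheet U (branch z U)); split => //.
    by apply: open_nbhs_nbhs; split; [exact: sheet_open|split].
  have [c zc] := branch_nonempty zU.
  have [[oU cU _] vc Uc bc] := branch_joined zc; rewrite bc.
  apply: (@connected_from _ _ (point c)) => x [[[_ _ Ux] bx] Sx].
  have [c' v' xE] := ordinary_point Sx.
  have [|g pg] := @sheet_chain_path U c c' oU cU vc Uc.
    rewrite -bx xE branch_chain_point //; first exact: joined_refl.
    by split => //; move: Ux; rewrite xE base_chain_point.
  by rewrite xE; exact: path_connected_component pg.
split; last by rewrite /branching_locus -[X in _ `<=` X]setCK; exact: subsetC.
split.
- by split => //; exact: completion_admissible.
- by split => //; exact: completion_connected.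
- by split; [exact: completion_spread|exact: completion_complete].
- apply: (complete_surjective base_point_continuous lT lY hY fY cY
    completion_complete skelS ordS completion_dense).
  by exists (point [::]).
- split; last by apply: portly_sup skelS _ ordS; exact: ordinary_open.
  apply: portly_sup pT _ _; first by apply: opr; exact: ordinary_open.
  by move=> z; exact: ordS.
Qed.

(** The component [K U c] depends only on the class of [c], so a branch becomes a coherent family in
    [X]. Any selection [q] of points in the resulting intersections is continuous because [p] is a
    spread; points over [S] are thus treated like the others. *)
Lemma completion_universal (X : topologicalType) (p : X -> Y) (x : X) :
  covering_branched_over R S p -> p x = pr (point [::]) ->
  exists q : T -> X, [/\ continuous q, p \o q = pr & q (point [::]) = x].
Proof.
move=> cov; rewrite base_chain_point //= => px.
have [lX _] := covering_lc cov.
have [[_ _ [sp compl] sur _] _] := cov; have [hY _ _] := aY.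
pose K U c := connected_component (p @^-1` U) (transport p x c).
have Keq U c c' : valid c -> U (cend c) -> joined U c c' -> K U c = K U c'.
  move=> vc Uc j; apply/same_connected_component.
  exact: joined_transport cov px vc Uc j.
have Q z : exists x', forall U c, branch z U c -> K U c x'.
  pose chi U := [set x' | exists2 c, branch z U c & K U c x'].
  have chiE U c : branch z U c -> chi U = K U c.
    move=> zc; have [zU vc Uc bc] := branch_joined zc.
    apply/seteqP; split => [x' [c']|x' Kx']; last by exists c.
    by rewrite bc => j; rewrite (Keq U c c').
  have [|||x' x'P] := compl (pr z) chi.
  - by rewrite sur; exact: subset_closure.
  - move=> U zU; have [c zc] := branch_nonempty zU.
    have [_ vc Uc _] := branch_joined zc.
    exists (transport p x c); last by rewrite (chiE U c).
    by rewrite /preimage /= (transport_end (y0 := y0) cov).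
  - move=> U V zU zV UV x' [c zc Kc]; exists c; first exact: (branch_sub zU zV).
    by apply: sub_connected_component Kc; exact: preimage_subset.
  exists x' => U c zc; have [zU _ _ _] := branch_joined zc.
  by rewrite -(chiE U c zc); exact: x'P.
have [q qP] := choice Q.
have pq z : p (q z) = pr z.
  apply/esym/hausdorff_conn_nbhs => // U zU; have [c zc] := branch_nonempty zU.
  exact: (connected_component_sub (qP z U c zc)).
exists q; split.
- move=> z O qO; have [U] := spread_nbhs lY sp qO; rewrite pq => zU UO.
  have : nbhs z (sheet U (branch z U)).
    by apply: open_nbhs_nbhs; split; [exact: sheet_open|].
  apply: filterS => z' [z'U bz']; apply: UO.
  have [c zc] := branch_nonempty zU.
  apply: (connected_component_trans (y := transport p x c)).
    by apply: connected_component_sym; exact: qP.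
  by apply: qP; rewrite bz'.
- exact/funext.
(* The image of the empty chain and [x] lie in one component over a trivializing set around [y0], so
   they agree. *)
have [W [tW Wy _]] := triv_nbhs Sy0 filterT.
have [oW cW _ /(_ _ _ cov) ev] := tW.
apply: (evenly_covered_inj ev (x := x)); last by rewrite pq base_chain_point.
  apply: (qP (point [::]) W [::]); rewrite branch_chain_point //.
  exact: joined_refl.
by apply: connected_component_refl; rewrite /preimage /= px.
Qed.

End completion_covering.

Theorem proposition2p19 (R : realType) (Y : topologicalType) (S : set Y)
    (spaceY : admissible_space R Y) (connY : connected [set: Y])
    (skelS : skeletal S)
    (slscYS : semilocally_simply_connected R (set_type (~` S))) :
  exists (Yt : topologicalType) (pi : Yt -> Y),
    [/\ maximal_branched_over R S pi,
        forall (Z : topologicalType) (r : Z -> Y),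
          maximal_branched_over R S r -> isomorphic_over r pi &
        forall (X : topologicalType) (p : X -> Y),
          covering_branched_over R S p ->
          exists2 q : Yt -> X,
            covering_branched_over R (p @^-1` S) q & p \o q = pi].
Proof.
have [[y]|Y0] := pselect (exists y : Y, True); last first.
  have {}Y0 : Y -> False by move=> y; apply: Y0; exists y.
  exists Y, id; have covY := @empty_covering R Y S Y0 spaceY.
  apply: (universal_conclusion skelS covY) => [X p cov|f _ _].
    exists (fun y => False_rect X (Y0 y)); first by move=> y; case: (Y0 y).
    by apply/funext => y; case: (Y0 y).
  by exists f; split=> y; case: (Y0 y).
move=> _; have [_ dS _] := skelS.
have [||y0 [_ Sy0]] := dS setT; [by exists y|exact: openT|].
have cov := completion_covering spaceY connY skelS slscYS Sy0.
have univ := @completion_universal R Y S y0 spaceY skelS slscYS Sy0.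
exists (completion R S y0), (@base_point R Y S y0).
apply: (universal_conclusion skelS cov) => [X p covp|].
  have [[_ _ _ sur _] _] := covp.
  have : range p (base_point (chain_point R S y0 [::])) by rewrite sur.
  by move=> [x _ /(univ _ _ _ covp) [q [cq pq _]]]; exists q.
apply: (universal_endo skelS cov (t0 := chain_point R S y0 [::])).
  by rewrite base_chain_point.
by move=> X p x covp; exact: univ.
Qed.
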